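(* Let $n\geq1$ and $w\in S_n$, and let $P_w(x,t)$ be defined as below (using any reduced word for $w$). Then $$\mathcal{K}^{(n)}_w(x,t)=\frac{P_w(x,t)}{\prod_{l=1}^{n}\prod_{\alpha\in A_l(w)}(1-x^\alpha T_l)},\qquad \mathcal{K}_w(x,t)=\frac{P_w(x,t)}{\prod_{l=1}^{\infty}\prod_{\alpha\in A_l(w)}(1-x^\alpha T_l)}.$$ (In particular $P_w$ does not depend on the reduced word used.)
   Context: $S_n\subseteq S_{n+1}\subseteq\cdots$ (as stabilizers of the larger integers), permutations compose as functions, $s_i$ is the transposition of $i,i+1$, $\ell(w)$ is the length. For $l\geq1$, $w^l$ is the increasing ordering of $w(1),\dots,w(l)$; $A_l(w)$ is the set of strictly increasing sequences $\alpha=(\alpha_1<\dots<\alpha_l)$ of positive integers with $\alpha_j\leq w^l_j$ for all $j$. For such $\alpha$, $s_i\alpha$ is the increasing sequence with entry set $\{s_i(\alpha_j)\}$, and $A_{l,i}(w)=\{\alpha\in A_l(w):s_i\alpha\notin A_l(w)\}$. $x^\alpha=\prod_jx_{\alpha_j}$, $T_l=t_1\cdots t_l$. On polynomials in $x_1,x_2,\dots$ (coefficients may involve $t$), $s_i$ swaps $x_i,x_{i+1}$, $\partial_if=(f-s_if)/(x_i-x_{i+1})$, $\pi_if=\partial_i(x_if)$; $\pi_w$ is the composition of the $\pi_i$ along a reduced word of $w$. For a partition $\lambda$ (non-increasing, eventually zero; $\ell(\lambda)$ = number of non-zero parts), $K_{\lambda,w}=\pi_w(\prod_ix_i^{\lambda_i})$,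 $t^\lambda=\prod t_i^{\lambda_i}$, $\mathcal{K}^{(n)}_w=\sum_{\ell(\lambda)\leq n}K_{\lambda,w}t^\lambda$, $\mathcal{K}_w=\sum_\lambda K_{\lambda,w}t^\lambda$. For $w$ and $i$ with $\ell(s_iw)>\ell(w)$, $N_{w,i}(x,t)=\prod_{l\geq1}\prod_{\alpha\in A_{l,i}(w)}(1-x^{s_i\alpha}T_l)$ (a finite product). Given a reduced word, i.e. $w_0=\mathrm{Id}$, $w_j=s_{i_j}w_{j-1}$ with $\ell(w_j)=j$ for $1\leq j\leq m=\ell(w)$ and $w_m=w$, define $P_{w_0}=1$ and $P_{w_j}=\pi_{i_j}\big(P_{w_{j-1}}N_{w_{j-1},i_j}\big)$ ($\pi$ acting on the $x$-variables); $P_w:=P_{w_m}$. *)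

(* Defs.v *)
From HB Require Import structures.
From mathcomp Require Import all_boot all_algebra.
From mathcomp Require Import boolp classical_sets functions cardinality fsbigop.
From mathcomp Require Import finmap monalg.

Set Implicit Arguments.
Unset Strict Implicit.
Unset Printing Implicit Defensive.

Import GRing.Theory.
Local Open Scope classical_set_scope.
Local Open Scope ring_scope.

(* The ring R[[I]] of formal power series in variables indexed by an arbitrary
   type I (all families of coefficients indexed by monomials of finite
   support), with the Cauchy product. *)
Section Series.
Variables (I : choiceType) (R : comNzRingType).
Implicit Types m d : {cmonom I}.

Definition mseries : Type := {cmonom I} -> R.

HB.instance Definition _ := GRing.Zmodule.copy mseries ({cmonom I} -> R).

Definition decomps m : set ({cmonom I} * {cmonom I}) :=
  [set p | mmul p.1 p.2 = m].

Definition mseries_one : mseries := fun m => (m == mone)%:R.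

Definition mseries_mul (f g : mseries) : mseries :=
  fun m => \sum_(p \in decomps m) f p.1 * g p.2.

Definition mdivs m : set {cmonom I} := [set d | exists e, mmul d e = m].

Lemma finite_mdivs m : finite_set (mdivs m).
Proof.
pose T := {ffun finsupp m -> 'I_(mdeg m).+1}.
pose h (t : T) : {cmonom I} :=
  CMonom [fsfun i : finsupp m => (t i : nat) | 0%N].
have hE (t : T) (i : finsupp m) : h t (val i) = t i.
  by rewrite fsfun_ffun valK.
have hout (t : T) i : i \notin finsupp m -> h t i = 0%N.
  by move=> im; rewrite fsfun_ffun insubN.
apply: (@sub_finite_set _ _ (h @` setT)); last exact/finite_image/finite_finset.
move=> d [e de].
have dm i : (d i <= m i)%N by rewrite -de cmM leq_addr.
have mi i : (m i <= mdeg m)%N.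
  rewrite mdegE; case: (boolP (i \in finsupp m)) => im; last first.
    by move: im; rewrite -cmE_eq0 => /eqP ->.
  by rewrite (big_fsetD1 i) //= leq_addr.
exists [ffun i => inord (d (val i))] => //; apply/eqP/cmP => i.
case: (boolP (i \in finsupp m)) => im.
  by rewrite (hE _ [` im]%fset) ffunE inordK // ltnS (leq_trans (dm _)).
rewrite hout //; move: im; rewrite -cmE_eq0 => /eqP mi0.
by have := dm i; rewrite mi0 leqn0 => /eqP.
Qed.

Lemma finite_decomps m : finite_set (decomps m).
Proof.
apply: (@sub_finite_set _ _ (mdivs m `*` mdivs m)); last first.
  exact: finite_setX (finite_mdivs m) (finite_mdivs m).
move=> [d e] /= de; split; first by exists e.
by exists d; rewrite mulmC.
Qed.

(* A polynomial with the same coefficients as f at all divisors of m. *)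
Definition mtrunc m (f : mseries) : {malg R[{cmonom I}]} :=
  [malg d in fset_set (mdivs m) => f d].

Lemma mcoeff_mtrunc m f d : mdivs m d -> (mtrunc m f)@_d = f d.
Proof.
move=> md; rewrite /mtrunc mcoeffE in_fset_set; last exact: finite_mdivs.
by rewrite mem_set.
Qed.

Lemma mseries_mulE (D : {fset {cmonom I}}) f g m :
  mdivs m `<=` [set` D] ->
  mseries_mul f g m =
    \sum_(d <- D) \sum_(e <- D) (f d * g e) *+ (mmul d e == m).
Proof.
move=> mD; pose r := [seq p <- [seq (d, e) | d <- D, e <- D] |
  mmul p.1 p.2 == m].
have ur : uniq r.
  by rewrite filter_uniq // allpairs_uniq ?fset_uniq // => -[? ?] [? ?] _ _ [-> ->].
have -> : mseries_mul f g m = \sum_(p \in [set` r]) f p.1 * g p.2.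
  apply: eq_fsbigl; apply/seteqP; split=> -[d e] /=; rewrite mem_filter /=.
    move=> de; rewrite de eqxx /=; apply/allpairsP; exists (d, e); split=> //=.
      by apply: mD; exists e.
    by apply: mD; exists d; rewrite mulmC.
  by case/andP => /eqP.
rewrite -fsbig_seq // /r big_filter big_mkcond /=.
rewrite big_allpairs /=.
by apply: eq_bigr => d _; apply: eq_bigr => e _; case: eqP.
Qed.

Lemma mseries_mul_poly (p q : {malg R[{cmonom I}]}) m :
  mseries_mul (fun d => p@_d) (fun d => q@_d) m = (p * q)@_m.
Proof.
pose D : {fset {cmonom I}} := (msupp p `|` msupp q `|` fset_set (mdivs m))%fset.
rewrite (@mseries_mulE D) ?(@mcoeffMlw _ _ D D) //.
- by apply/fsubsetP => x xp; rewrite !inE xp.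
- by apply/fsubsetP => x xq; rewrite !inE xq orbT.
move=> x /mem_set mx; rewrite /= !inE in_fset_set ?mx ?orbT //.
exact: finite_mdivs.
Qed.

Lemma eq_mseries_mul (f f' g g' : mseries) m :
    (forall d, mdivs m d -> f d = f' d) -> (forall d, mdivs m d -> g d = g' d) ->
  mseries_mul f g m = mseries_mul f' g' m.
Proof.
move=> ff gg; apply: eq_fsbigr => -[d e] /set_mem /= de.
by rewrite ff ?gg //; [exists d; rewrite mulmC|exists e].
Qed.

Lemma mdivs_trans d m e : mdivs m d -> mdivs d e -> mdivs m e.
Proof. by move=> [x <-] [y <-]; exists (mmul y x); rewrite mulmA. Qed.

Lemma mdivs_refl m : mdivs m m.
Proof. by exists mone; rewrite mulm1. Qed.

Lemma mseries_mul_trunc f g m d : mdivs m d ->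
  mseries_mul f g d = (mtrunc m f * mtrunc m g)@_d.
Proof.
move=> md; rewrite -mseries_mul_poly.
by apply: eq_mseries_mul => e /(mdivs_trans md) /mcoeff_mtrunc ->.
Qed.

Lemma mseries_mulA : associative mseries_mul.
Proof.
move=> f g h; apply/funext => m.
transitivity ((mtrunc m f * (mtrunc m g * mtrunc m h))@_m).
  rewrite -mseries_mul_poly; apply: eq_mseries_mul => d md.
    by rewrite mcoeff_mtrunc.
  exact: mseries_mul_trunc.
rewrite mulrA -mseries_mul_poly; apply: eq_mseries_mul => d md.
  by rewrite -mseries_mul_trunc.
by rewrite mcoeff_mtrunc.
Qed.

Lemma mseries_mulC : commutative mseries_mul.
Proof.
move=> f g; apply/funext => m.
by rewrite !(mseries_mul_trunc _ _ (mdivs_refl m)) mulrC.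
Qed.

Lemma mseries_mul1 : left_id mseries_one mseries_mul.
Proof.
move=> f; apply/funext => m.
rewrite -[RHS](mcoeff_mtrunc f (mdivs_refl m)) -[in RHS](mul1r (mtrunc m f)).
rewrite -mseries_mul_poly; apply: eq_mseries_mul => d md.
  by rewrite /mseries_one mcoeff1.
by rewrite mcoeff_mtrunc.
Qed.

Lemma mseries_mulDl : left_distributive mseries_mul +%R.
Proof.
move=> f g h; apply/funext => m.
transitivity (((mtrunc m f + mtrunc m g) * mtrunc m h)@_m).
  rewrite -mseries_mul_poly; apply: eq_mseries_mul => d md.
    by rewrite mcoeffD (mcoeff_mtrunc f md) (mcoeff_mtrunc g md).
  by rewrite (mcoeff_mtrunc h md).
transitivity (mseries_mul f h m + mseries_mul g h m) => //.
rewrite !(@mseries_mul_trunc _ _ m m); [|exact: mdivs_refl..].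
by rewrite (mulrDl (mtrunc m f)) mcoeffD.
Qed.

Lemma mseries_oner_neq0 : mseries_one != 0 :> mseries.
Proof.
apply/eqP => /(congr1 (fun f : mseries => f mone)) /eqP.
by rewrite /mseries_one eqxx oner_eq0.
Qed.

HB.instance Definition _ := GRing.Zmodule_isComNzRing.Build mseries
  mseries_mulA mseries_mulC mseries_mul1 mseries_mulDl mseries_oner_neq0.

Definition mseries_unit : {pred mseries} :=
  fun f => `[< exists g : mseries, g * f = 1 >].

Definition mseries_inv (f : mseries) : mseries :=
  xget f [set g : mseries | g * f = 1].

Lemma mseries_mulVx : {in mseries_unit, left_inverse 1 mseries_inv *%R}.
Proof. by move=> f /asboolP /(xgetPex f). Qed.

Lemma mseries_unitPl (f g : mseries) : g * f = 1 -> mseries_unit f.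
Proof. by move=> gf; apply/asboolP; exists g. Qed.

Lemma mseries_invr_out : {in [predC mseries_unit], mseries_inv =1 id}.
Proof.
move=> f /asboolP nf; rewrite /mseries_inv xgetPN // => g gf.
by apply: nf; exists g.
Qed.

HB.instance Definition _ := GRing.ComNzRing_hasMulInverse.Build mseries
  mseries_mulVx mseries_unitPl mseries_invr_out.

Definition mseries_of (p : {malg R[{cmonom I}]}) : mseries := fun m => p@_m.

Lemma mseries_ofM p q : mseries_of (p * q) = mseries_of p * mseries_of q.
Proof. by apply/funext => m; rewrite [RHS]mseries_mul_poly. Qed.

Lemma mseries_of1 : mseries_of 1 = 1.
Proof. by apply/funext => m; rewrite /mseries_of mcoeff1. Qed.

(* Division is meaningful for denominators with constant coefficient 1. *)
Lemma mseries_unit1 (f : mseries) : f mone = 1 -> f \is a GRing.unit.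
Proof.
move=> f1; pose z : mseries := 1 - f.
have fz : f = 1 - z by rewrite /z opprB addrC subrK.
have z1 : z mone = 0.
  by rewrite /z [LHS](_ : _ = (mone == mone :> {cmonom I})%:R - f mone) //
    f1 eqxx subrr.
have zX k m : (mdeg m < k)%N -> (z ^+ k) m = 0.
  elim: k m => // k IH m mk; rewrite exprS.
  rewrite [LHS](_ : _ = mseries_mul z (z ^+ k) m) // /mseries_mul.
  apply: fsbig1 => -[d e] /= de.
  have [->|d1] := eqVneq d mone; first by rewrite z1 mul0r.
  rewrite IH ?mulr0 // -ltnS (leq_trans _ mk) // ltnS -de mdegM.
  by rewrite -[X in (X < _)%N]add0n ltn_add2r lt0n mdeg_eq0.
pose S N : mseries := \sum_(k < N) z ^+ k.
have SE N m : (mdeg m < N)%N -> S N m = S (mdeg m).+1 m.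
  move=> mN; rewrite /S -!(big_mkord xpredT (fun k => z ^+ k)).
  rewrite (big_cat_nat (leq0n _) mN) /=.
  rewrite [LHS](_ : _ = (\sum_(0 <= k < (mdeg m).+1) z ^+ k) m +
    (\sum_((mdeg m).+1 <= k < N) z ^+ k) m) //.
  rewrite [X in _ + X](_ : _ = 0) ?addr0 // big_nat.
  elim/big_rec: _ => // k x /andP[mk _] xm.
  by rewrite [LHS](_ : _ = (z ^+ k) m + x m) // zX // xm addr0.
apply/asboolP; exists (fun m => S (mdeg m).+1 m); apply/funext => m.
transitivity ((S (mdeg m).+1 * f) m).
  apply: eq_mseries_mul => // d [e de]; rewrite -(SE (mdeg m).+1) // ltnS -de mdegM.
  exact: leq_addr.
have -> : S (mdeg m).+1 * f = 1 - z ^+ (mdeg m).+1.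
  by rewrite -opprB subrX1 -mulNr opprB -fz mulrC.
by rewrite [LHS](_ : _ = (1 : mseries) m - (z ^+ (mdeg m).+1) m) // zX // subr0.
Qed.

(* Limit of a sequence whose coefficients are all eventually constant. *)
Definition mseries_lim (u : nat -> mseries) : mseries :=
  fun m => xget 0 [set c | exists N, forall L, (N <= L)%N -> u L m = c].

End Series.

(* Permutations of the positive integers are functions on nat fixing 0. *)
Definition in_S (n : nat) (w : nat -> nat) : Prop :=
  [/\ bijective w, w 0%N = 0%N & forall i, (n < i)%N -> w i = i].

Definition s_ (i k : nat) : nat :=
  if k == i then i.+1 else if k == i.+1 then i else k.

(* The word i_1 :: i_2 :: ... :: i_m stands for s_{i_1} s_{i_2} ... s_{i_m}:
   the head is the letter applied last. *)
Fixpoint word_perm (a : seq nat) : nat -> nat :=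
  if a is i :: a' then s_ i \o word_perm a' else id.

Definition has_word (w : nat -> nat) (m : nat) : Prop :=
  exists a : seq nat, [/\ all (leq 1) a, word_perm a =1 w & size a = m].

Definition ell (w : nat -> nat) : nat :=
  xget 0%N [set m | has_word w m /\ forall k, has_word w k -> (m <= k)%N].

Fixpoint reduced (a : seq nat) : Prop :=
  if a is i :: a' then
    [/\ (0 < i)%N, reduced a' & ell (word_perm a) = size a]
  else True.

Definition reduced_word (w : nat -> nat) (a : seq nat) : Prop :=
  reduced a /\ word_perm a =1 w.

(* w^l *)
Definition wsort (l : nat) (w : nat -> nat) : seq nat :=
  sort leq [seq w k | k <- iota 1 l].

(* The entry alpha_j of the informal notation is nth 0 alpha j.-1. *)
Definition A_ (l : nat) (w : nat -> nat) : set (seq nat) :=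
  [set alpha | [/\ size alpha = l, all (leq 1) alpha, sorted ltn alpha &
    forall j, (j < l)%N -> (nth 0 alpha j <= nth 0 (wsort l w) j)%N]].

Definition s_seq (i : nat) (alpha : seq nat) : seq nat :=
  sort leq [seq s_ i k | k <- alpha].

Definition Ai_ (l i : nat) (w : nat -> nat) : set (seq nat) :=
  [set alpha | A_ l w alpha /\ ~ A_ l w (s_seq i alpha)].

(* inl i is the variable x_i and inr i the variable t_i; the indices start
   at 1, and x_0, t_0 do not occur. *)
Notation var := (nat + nat)%type.

Section Polynomials.
Variable R : comNzRingType.

Local Notation pol := {malg R[{cmonom var}]}.

Definition X (i : nat) : pol := << ucm (inl i : var) >>.
Definition T (i : nat) : pol := << ucm (inr i : var) >>.

Definition xmon (alpha : seq nat) : pol := \prod_(k <- alpha) X k.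
Definition Tprod (l : nat) : pol := \prod_(1 <= k < l.+1) T k.

(* Substitution of polynomials for the variables. *)
Definition psubst (h : var -> pol) (f : pol) : pol :=
  mmap malgC (fun m : {cmonom var} => \prod_(v <- finsupp m) h v ^+ m v) f.

Definition swap (i : nat) : pol -> pol :=
  psubst (fun v => match v with inl k => X (s_ i k) | inr k => T k end).

(* Exact division by x_i - x_{i+1}, which is not a zero divisor. *)
Definition divdiff (i : nat) (f : pol) : pol :=
  xget 0 [set g : pol | (X i - X i.+1) * g = f - swap i f].

Definition dpi (i : nat) (f : pol) : pol := divdiff i (X i * f).

Definition dpi_word (a : seq nat) (f : pol) : pol := foldr dpi f a.

Definition dpi_perm (w : nat -> nat) : pol -> pol :=
  dpi_word (xget [::] (reduced_word w)).

(* A partition is the list of its nonzero parts, so that the number of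
   nonzero parts is the size. *)
Definition is_partition (lam : seq nat) : Prop :=
  sorted geq lam /\ all (leq 1) lam.

Definition xpart (lam : seq nat) : pol :=
  \prod_(k < size lam) X k.+1 ^+ nth 0%N lam k.
Definition tpart (lam : seq nat) : pol :=
  \prod_(k < size lam) T k.+1 ^+ nth 0%N lam k.

Definition Kpol (lam : seq nat) (w : nat -> nat) : pol :=
  dpi_perm w (xpart lam).

(* Given a monomial m, only the partition lam with t^lam equal to the t-part of
   m can contribute, so the sum is finite. *)
Definition Ksum (L : set (seq nat)) (w : nat -> nat) : mseries var R :=
  fun m => \sum_(lam \in L) (Kpol lam w * tpart lam)@_m.

Definition Kn (n : nat) (w : nat -> nat) : mseries var R :=
  Ksum [set lam | is_partition lam /\ (size lam <= n)%N] w.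

Definition Kall (w : nat -> nat) : mseries var R :=
  Ksum [set lam | is_partition lam] w.

(* \big over a set ranges over the indices whose factor differs from 1; there
   are finitely many of them, since Ai_ l i w is empty for large l. *)
Definition Npol (w : nat -> nat) (i : nat) : pol :=
  \big[*%R/1]_(l \in [set l | (0 < l)%N])
    \big[*%R/1]_(alpha \in Ai_ l i w) (1 - xmon (s_seq i alpha) * Tprod l).

Fixpoint Ppol (a : seq nat) : pol :=
  if a is i :: a' then dpi i (Ppol a' * Npol (word_perm a') i) else 1.

Definition denom (n : nat) (w : nat -> nat) : pol :=
  \prod_(1 <= l < n.+1)
    \big[*%R/1]_(alpha \in A_ l w) (1 - xmon alpha * Tprod l).

(* The factors with l > mdeg m do not affect the coefficient of m, hence the
   limit exists. *)
Definition denom_infty (w : nat -> nat) : mseries var R :=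
  mseries_lim (fun L => mseries_of (denom L w)).

End Polynomials.

(* Main.v *)
(* By induction along the word, P_w = K_w D_w, where D_w denotes the denominator
   product.
   - For the identity, A_l consists of (1, ..., l) only and K = sum x^lam t^lam
     is a product of geometric series: removing the columns of height n from
     the Young diagrams gives (1 - x_1...x_n T_n) K^(n) = K^(n-1).
   - If l(s_i w) > l(w), then A_l(s_i w) is the disjoint union of A_l(w) and
     s_i A_{l,i}(w), so D_{s_i w} = D_w N_{w,i}, and this set is s_i-stable, so
     D_{s_i w} is s_i-symmetric.  Since pi_i commutes with multiplication by
     s_i-symmetric factors,
       pi_i (P_w N_{w,i}) = pi_i (K_w D_{s_i w}) = K_{s_i w} D_{s_i w}.
   That pi_w does not depend on the reduced word is Matsumoto's theorem, obtained
   here from the strong exchange property.  The power series identities are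
   checked on polynomials, modulo terms of large total degree; this suffices
   because t^lam has degree |lam|. *)

Require Import Defs.
From HB Require Import structures.
From mathcomp Require Import all_boot all_algebra.
From mathcomp Require Import boolp classical_sets functions cardinality fsbigop.
From mathcomp Require Import finmap monalg.
From mathcomp Require Import zify ring.

Import GRing.Theory.
Local Open Scope ring_scope.

Set Implicit Arguments.
Unset Strict Implicit.
Unset Printing Implicit Defensive.

(** * Isobaric divided differences *)

Lemma fsum_diff (V : zmodType) (I : choiceType) (D E : set I) (F : I -> V) :
    finite_set E -> (D `<=` E)%classic ->
  \sum_(x \in E) F x - \sum_(x \in D) F x = \sum_(x \in (E `&` ~` D)%classic) F x.
Proof.
move=> fE DE; rewrite (fsbigID D) //.
have -> : (E `&` D = D)%classic by rewrite setIC; apply/setIidPl.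
by rewrite addrAC subrr add0r.
Qed.

Lemma raddf_fsum (V W : zmodType) (phi : {additive V -> W}) (I : choiceType)
    (D : set I) (F : I -> V) (G : I -> W) :
    finite_set D -> (forall x, phi (F x) = G x) ->
  phi (\sum_(x \in D) F x) = \sum_(x \in D) G x.
Proof.
move=> fD FG; rewrite !fsbig_finite // raddf_sum.
by apply: eq_bigr => x _; exact: FG.
Qed.

Section RingIdentities.
Variable A : comNzRingType.
Implicit Types a b c d f g h k : A.

(** The Leibniz rule for divided differences, freed of division: [f'] and [g'] are quotients by
    [d]. *)
Lemma twisted_leibniz d f sf g sg f' g' :
  d * f' = f - sf -> d * g' = g - sg ->
  d * (f' * g + sf * g') = f * g - sf * sg.
Proof. by move=> ff gg; rewrite mulrDr mulrA ff mulrCA gg; ring. Qed.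

Lemma rmorph_1subM (phi : {rmorphism A -> A}) x t x' :
  phi x = x' -> phi t = t -> phi (1 - x * t) = 1 - x' * t.
Proof. by move=> <- pt; rewrite rmorphB rmorph1 rmorphM pt. Qed.

(** The induction step along the word in abstract form: [k], [d], [p], [c] stand for K_w, D_w, P_w,
    N_{w,i}, then [e] for the denominator of s_i w and [phi] for pi_i. *)
Lemma raddf_step (phi : {additive A -> A}) k d p c e :
  e = d * c -> phi (k * e) = phi k * e ->
  phi ((k * d - p) * c) = phi k * e - phi (p * c).
Proof. by move=> -> ke; rewrite mulrBl raddfB -mulrA ke. Qed.

End RingIdentities.

Lemma s_K i : involutive (s_ i).
Proof. by move=> k; rewrite /s_; repeat case: eqP => //; lia. Qed.

Lemma s_i i : s_ i i = i.+1.
Proof. by rewrite /s_ eqxx. Qed.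

Lemma s_iS i : s_ i i.+1 = i.
Proof. by rewrite -[in LHS](s_i i) s_K. Qed.

Lemma s_id i k : k != i -> k != i.+1 -> s_ i k = k.
Proof. by rewrite /s_ => /negbTE -> /negbTE ->. Qed.

Lemma s_comm i j k : (i.+1 < j)%N -> s_ i (s_ j k) = s_ j (s_ i k).
Proof. by rewrite /s_; repeat case: eqP => //; lia. Qed.

Lemma s_braid i k : s_ i (s_ i.+1 (s_ i k)) = s_ i.+1 (s_ i (s_ i.+1 k)).
Proof. by rewrite /s_; repeat case: eqP => //; lia. Qed.

(* x, s and p stand for X, swap and dpi, kept abstract so that they are never
   unfolded. *)
Section IsobaricOperators.
Variables (A : comNzRingType) (x : nat -> A) (s : nat -> {rmorphism A -> A}).
Variable p : nat -> A -> A.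
Hypothesis mulXB_inj : forall i j f g, i != j ->
  (x i - x j) * f = (x i - x j) * g -> f = g.
Hypothesis sX : forall i k, s i (x k) = x (s_ i k).
Hypothesis sK : forall i, involutive (s i).
Hypothesis s_comm : forall i j f, (i.+1 < j)%N -> s i (s j f) = s j (s i f).
Hypothesis s_braid : forall i f, s i (s i.+1 (s i f)) = s i.+1 (s i (s i.+1 f)).
Hypothesis pE : forall i f, (x i - x i.+1) * p i f = x i * f - x i.+1 * s i f.
Implicit Types f g h : A.

Lemma isobaric_eq i f g : (x i - x i.+1) * f = (x i - x i.+1) * g -> f = g.
Proof. by apply: mulXB_inj; rewrite (ltn_eqF (ltnSn i)). Qed.

Lemma isobaric_zmod_morphism i : zmod_morphism (p i).
Proof.
by move=> f g; apply: (@isobaric_eq i); rewrite mulrBr !pE rmorphB; ring.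
Qed.

Lemma isobaricMr i f g : s i g = g -> p i (f * g) = p i f * g.
Proof.
by move=> gg; apply: (@isobaric_eq i); rewrite mulrA !pE rmorphM gg; ring.
Qed.

(** Both x_i - x_{i+1} and the numerator x_i f - x_{i+1} s_i f change sign under s_i. *)
Lemma isobaric_sym i f : s i (p i f) = p i f.
Proof.
apply: (@isobaric_eq i); rewrite pE.
have := congr1 (fun h => - s i h) (pE i f).
rewrite rmorphM !rmorphB !rmorphM /= sK !sX s_i s_iS => e.
by transitivity (- ((x i.+1 - x i) * s i (p i f))); [ring|rewrite e; ring].
Qed.

Lemma isobaricE_swap j a b a' b' f g h : s j a = a' -> s j b = b' ->
    (a - b) * h = a * f - b * g ->
  (a' - b') * s j h = a' * s j f - b' * s j g.
Proof.
by move=> <- <- /(congr1 (s j)); rewrite rmorphM !rmorphB !rmorphM.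
Qed.

(** After multiplication by both differences, each side becomes the same combination of f, s_i f,
    s_j f and s_i s_j f. *)
Lemma isobaric_comm i j f : (i.+1 < j)%N -> p i (p j f) = p j (p i f).
Proof.
move=> ij; apply: (@isobaric_eq j); apply: (@isobaric_eq i).
have sj : s i (x j) = x j by rewrite sX s_id //; lia.
have sj1 : s i (x j.+1) = x j.+1 by rewrite sX s_id //; lia.
have si : s j (x i) = x i by rewrite sX s_id //; lia.
have si1 : s j (x i.+1) = x i.+1 by rewrite sX s_id //; lia.
have e1 := pE i f; have e2 := pE j f.
have e3 := isobaricE_swap si si1 e1; have e4 := isobaricE_swap sj sj1 e2.
rewrite (s_comm f ij) in e4.
rewrite mulrCA (pE i (p j f)) (pE j (p i f)).
transitivity (x i * ((x j - x j.+1) * p j f) -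
  x i.+1 * ((x j - x j.+1) * s i (p j f))); first by ring.
transitivity (x j * ((x i - x i.+1) * p i f) -
  x j.+1 * ((x i - x i.+1) * s j (p i f))); first by rewrite e1 e2 e3 e4; ring.
ring.
Qed.

(* Multiplied by the Vandermonde product of x_i, x_{i+1}, x_{i+2}, both sides
   become the antisymmetrization of x_i^2 x_{i+1} f. *)
Lemma isobaric_braid i f : p i (p i.+1 (p i f)) = p i.+1 (p i (p i.+1 f)).
Proof.
have ne2 : i != i.+2 by lia.
have ia : s i (x i) = x i.+1 by rewrite sX s_i.
have ib : s i (x i.+1) = x i by rewrite sX s_iS.
have ic : s i (x i.+2) = x i.+2 by rewrite sX s_id //; lia.
have ja : s i.+1 (x i) = x i by rewrite sX s_id //; lia.
have jb : s i.+1 (x i.+1) = x i.+2 by rewrite sX s_i.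
have jc : s i.+1 (x i.+2) = x i.+1 by rewrite sX s_iS.
have l1 := pE i f; have l2 := isobaricE_swap ja jb l1.
have l3 := isobaricE_swap ia ic l2.
have l4 := pE i.+1 (p i f); have l5 := isobaricE_swap ib ic l4.
rewrite (isobaric_sym i f) in l5.
have l6 := pE i (p i.+1 (p i f)).
have r1 := pE i.+1 f; have r2 := isobaricE_swap ib ic r1.
have r3 := isobaricE_swap ja jc r2.
have r4 := pE i (p i.+1 f); have r5 := isobaricE_swap ja jb r4.
rewrite (isobaric_sym i.+1 f) in r5; rewrite -(s_braid i f) in r3.
have r6 := pE i.+1 (p i (p i.+1 f)).
apply: (@isobaric_eq i); apply: (@isobaric_eq i.+1); apply: (mulXB_inj ne2).
move: l1 l2 l3 l4 l5 l6 r1 r2 r3 r4 r5 r6.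
move: (x i) (x i.+1) (x i.+2) => a b c.
move: (p i (p i.+1 (p i f))) (p i.+1 (p i (p i.+1 f))) => k k'.
move=> l1 l2 l3 l4 l5 l6 r1 r2 r3 r4 r5 r6.
transitivity (a * (a - c) * ((b - c) * p i.+1 (p i f)) -
  b * (b - c) * ((a - c) * s i (p i.+1 (p i f)))).
  by rewrite l6; ring.
rewrite l4 l5.
transitivity (a * b * ((a - b) * p i f) - a * c * ((a - c) * s i.+1 (p i f)) +
  b * c * ((b - c) * s i (s i.+1 (p i f)))); first by ring.
rewrite l1 l2 l3.
transitivity (a * a * ((b - c) * p i.+1 f) - b * b * ((a - c) * s i (p i.+1 f)) +
  c * c * ((a - b) * s i.+1 (s i (p i.+1 f)))).
  by rewrite r1 r2 r3; ring.
transitivity (b * (a - c) * ((a - b) * p i (p i.+1 f)) -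
  c * (a - b) * ((a - c) * s i.+1 (p i (p i.+1 f)))).
  by rewrite r4 r5; ring.
transitivity ((a - c) * ((a - b) * ((b - c) * k'))); last by ring.
by rewrite r6; ring.
Qed.

End IsobaricOperators.

(** * The polynomial ring and substitution of variables *)

Section Polynomials.
Variable R : comNzRingType.
Local Notation pol := {malg R[{cmonom var}]}.
Implicit Types (f g : pol) (m : {cmonom var}).

Lemma malgUM (m m' : {cmonom var}) :
  << mmul m m' >> = << m >> * << m' >> :> pol.
Proof.
by rewrite (malgM_def << m >> << m' >>) fgmulUU mulr1.
Qed.

Lemma malgUC (c : R) m : << c *g m >> = c%:MP * << m >> :> pol.
Proof.
by rewrite (malgM_def c%:MP << m >>) fgmulUU mulr1 mul1m.
Qed.

Lemma cmonom_ind (P : {cmonom var} -> Prop) :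
  P mone -> (forall v m, P m -> P (mmul (ucm v) m)) -> forall m, P m.
Proof.
move=> P1 PU m; move: {2}(mdeg m) (leqnn (mdeg m)) => d.
elim: d m => [|d IH] m; first by rewrite leqn0 mdeg_eq0 => /eqP ->.
have [->//|m1] := eqVneq m mone.
have [v vm] : exists v, m v != 0%N.
  apply: contrapT => /forallNP h; case/eqP: m1; apply/eqP/cmP => v.
  by rewrite cm1; apply/eqP; move: (h v); case: eqP.
have mE : m = mmul (ucm v) (divcm m (ucm v)).
  apply/eqP/cmP => u; rewrite cmM divcmE cmU.
  by case: eqP => [<-|_]; rewrite ?subn0 // subnKC // lt0n.
by rewrite mE mdegM mdegU add1n ltnS => /IH/PU.
Qed.

Lemma pol_ind (P : pol -> Prop) :
    (forall c, P c%:MP) -> (forall v, P << ucm v >>) ->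
    (forall f g, P f -> P g -> P (f + g)) ->
    (forall f g, P f -> P g -> P (f * g)) ->
  forall f, P f.
Proof.
move=> PC PU PD PM f; rewrite (monalgE f).
apply: (big_ind P) => // [|m _]; first by rewrite -malgC0E.
rewrite malgUC; apply: (PM _ _ (PC _)).
elim/cmonom_ind: m => [|v m IH];   first by have := PC 1.
rewrite (malgUM (ucm v) m); exact: (PM << ucm v >> << m >> (PU v) IH).
Qed.

(** The monomial part of [psubst], named so that its multiplicativity makes [psubst] a ring morphism
    through [mmap]. *)
Definition mon_eval (h : var -> pol) m : pol := \prod_(v <- finsupp m) h v ^+ m v.

Lemma mon_evalEw h m (D : {fset var}) : (finsupp m `<=` D)%fset ->
  mon_eval h m = \prod_(v <- D) h v ^+ m v.
Proof.
move=> mD; rewrite /mon_eval (big_fset_incl _ mD) // => v _.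
by rewrite -cmE_eq0 => /eqP ->.
Qed.

Lemma mon_eval_is_mmorphism h : mmorphism (mon_eval h).
Proof.
split=> [m m'|]; last by rewrite /mon_eval mdom1 big_seq_fset0.
rewrite [LHS](mon_evalEw h (fsubset_refl _)) mdomD.
rewrite (mon_evalEw h (fsubsetUl _ (finsupp m'))).
rewrite (mon_evalEw h (fsubsetUr (finsupp m) _)) -big_split /=.
by apply: eq_bigr => v _; rewrite cmM exprD.
Qed.

HB.instance Definition _ h :=
  isMultiplicative.Build _ _ (mon_eval h) (mon_eval_is_mmorphism h).

HB.instance Definition _ h :=
  GRing.RMorphism.copy (@psubst R h) (mmap malgC (mon_eval h)).

HB.instance Definition _ i := GRing.RMorphism.copy (@swap R i) (@psubst R
  (fun v => match v with inl k => X R (s_ i k) | inr k => T R k end)).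

Lemma psubstU h v : psubst h << ucm v >> = h v :> pol.
Proof.
by rewrite /psubst mmapU mul1r mdomU big_seq_fset1 cmUU expr1.
Qed.

Lemma psubstC h (c : R) : psubst h c%:MP = c%:MP.
Proof. by rewrite /psubst mmapU mdom1 big_seq_fset0 mulr1. Qed.

Lemma swapX i k : swap i (X R k) = X R (s_ i k).
Proof. exact: psubstU. Qed.

Lemma swapT i k : swap i (T R k) = T R k.
Proof. exact: psubstU. Qed.

Lemma swapC i (c : R) : swap i c%:MP = c%:MP.
Proof. exact: psubstC. Qed.

Lemma swapD i f g : swap i (f + g) = swap i f + swap i g.
Proof. exact: (rmorphD (swap i)). Qed.

Lemma swapM i f g : swap i (f * g) = swap i f * swap i g.
Proof. exact: (rmorphM (swap i)). Qed.

(** * The filtration by order, that is, by the lowest total degree in x and t *)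

Definition mord (d : nat) f := forall m, (mdeg m < d)%N -> f@_m = 0.

Lemma mordW d e f : (e <= d)%N -> mord d f -> mord e f.
Proof. by move=> ed fd m me; apply: fd; exact: leq_trans me ed. Qed.

Lemma mord_zero d : mord d 0.
Proof. by move=> m _; rewrite mcoeff0. Qed.

Lemma mordD d f g : mord d f -> mord d g -> mord d (f + g).
Proof. by move=> fd gd m md; rewrite mcoeffD fd // gd // addr0. Qed.

Lemma mordN d f : mord d f -> mord d (- f).
Proof. by move=> fd m md; rewrite mcoeffN fd // oppr0. Qed.

Lemma mordB d f g : mord d f -> mord d g -> mord d (f - g).
Proof. by move=> fd gd; apply: mordD => //; exact: mordN. Qed.

Lemma mord_sum d (I : Type) (r : seq I) (P : pred I) (F : I -> pol) :
  (forall k, P k -> mord d (F k)) -> mord d (\sum_(k <- r | P k) F k).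
Proof. by move=> Fd; apply: big_ind => //; [exact: mord_zero|exact: mordD]. Qed.

Lemma mordM d e f g : mord d f -> mord e g -> mord (d + e) (f * g).
Proof.
move=> fd ge m mde; rewrite -mseries_mul_poly; apply: fsbig1 => -[p q] /= pq.
have [pd|dp] := ltnP (mdeg p) d; first by rewrite fd // mul0r.
rewrite [X in _ * X]ge ?mulr0 // -(ltn_add2l d) (leq_trans _ mde) // ltnS -pq mdegM.
by rewrite leq_add2r.
Qed.

Lemma mordMl d f g : mord d f -> mord d (f * g).
Proof. by move=> fd; rewrite -[d]addn0; apply: mordM. Qed.

Lemma mordMr d f g : mord d g -> mord d (f * g).
Proof. by rewrite mulrC; exact: mordMl. Qed.

Lemma mordX d f n : mord d f -> mord (n * d) (f ^+ n).
Proof. by move=> fd; elim: n => // n IH; rewrite exprS mulSn; apply: mordM. Qed.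

Lemma mord_prod (I : Type) (r : seq I) (e : I -> nat) (F : I -> pol) :
  (forall k, mord (e k) (F k)) -> mord (\sum_(k <- r) e k) (\prod_(k <- r) F k).
Proof.
by move=> Fe; apply: (big_ind2 mord) => // d f d' f'; exact: mordM.
Qed.

Lemma mordU m : mord (mdeg m) << m >>.
Proof.
move=> m' mm'; rewrite mcoeffU1; case: eqP => // mE.
by move: mm'; rewrite mE ltnn.
Qed.

Lemma mord_inj f : (forall d, mord d f) -> f = 0.
Proof.
by move=> fd; apply/malgP => m; rewrite (fd (mdeg m).+1 m (ltnSn _)) mcoeff0.
Qed.

Lemma mordX1 i : mord 1 (X R i).
Proof. by rewrite -(mdegU (inl i : var)); exact: mordU. Qed.

Lemma mordT1 i : mord 1 (T R i).
Proof. by rewrite -(mdegU (inr i : var)); exact: mordU. Qed.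

Lemma mord_swap d i f : mord d f -> mord d (swap i f).
Proof.
move=> fd; rewrite (monalgE f) rmorph_sum; apply: mord_sum => m _.
have [md|dm] := ltnP (mdeg m) d.
  by rewrite fd // monalgU0 rmorph0; exact: mord_zero.
rewrite /= [swap _ _]mmapU; apply: mordMr; apply: (mordW dm).
apply: mord_prod => -[k|k]; rewrite -[X in mord X]muln1; apply: mordX.
  exact: mordX1.
exact: mordT1.
Qed.

Lemma mmulIl (k m m' : {cmonom var}) : (mmul k m == mmul k m') = (m == m').
Proof.
apply/eqP/eqP => [/eqP/cmP h|->//]; apply/eqP/cmP => v.
by have /eqP := h v; rewrite !cmM eqn_add2l => /eqP.
Qed.

Lemma mcoeffUMl (k : {cmonom var}) g m : (<< k >> * g)@_(mmul k m) = g@_m.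
Proof.
rewrite mcoeffMl msuppU1 big_seq_fset1 mcoeffUU.
rewrite [in RHS](monalgE g) raddf_sum /=; apply: eq_bigr => k' _.
by rewrite mul1r mmulIl mcoeffU.
Qed.

Lemma mcoeffUMl0 (k : {cmonom var}) g m :
  (forall m', mmul k m' <> m) -> (<< k >> * g)@_m = 0.
Proof.
move=> km; rewrite mcoeffMl msuppU1 big_seq_fset1.
by apply: big1 => k' _; case: eqP => [/km|].
Qed.

(** The coefficient of x_i m in (x_i - x_j) f vanishes for m of degree below d, so f has at m the
    coefficient that x_j f has at x_i m. This is 0 if x_j does not divide m, and otherwise the
    coefficient of f at x_i m / x_j, where the exponent of x_j has dropped; hence an induction on
    that exponent. *)
Lemma mord_cancel d i j f :
  i != j -> mord d.+1 ((X R i - X R j) * f) -> mord d f.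
Proof.
move=> ij fd.
have fE m : (mdeg m < d)%N -> f@_m = (X R j * f)@_(mmul (ucm (inl i : var)) m).
  move=> md; apply/eqP; rewrite -subr_eq0 -{1}(mcoeffUMl (ucm (inl i : var)) f m).
  rewrite -mcoeffB -(mulrBl f) fd //.
  by rewrite mdegM mdegU.
move=> m; move: {2}(m (inl j)) (erefl (m (inl j))) => e.
elim: e m => [|e IH] m me md; rewrite fE //.
  apply: mcoeffUMl0 => m' /(congr1 (fun p : {cmonom var} => p (inl j))).
  by rewrite !cmM !cmU me eqxx (inj_eq (@inl_inj _ _)) (negbTE ij).
pose m' := divcm m (ucm (inl j : var)).
have mE : m = mmul (ucm (inl j : var)) m'.
  apply/eqP/cmP => u; rewrite cmM divcmE cmU.
  by case: eqP => [<-|_]; rewrite ?subn0 // subnKC // me.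
have -> : mmul (ucm (inl i : var)) m =
    mmul (ucm (inl j : var)) (mmul (ucm (inl i : var)) m').
  by apply/eqP/cmP => u; rewrite mE !cmM addnCA.
rewrite (mcoeffUMl (ucm (inl j : var))); apply: IH.
  move: me; rewrite {1}mE !cmM !cmU eqxx (inj_eq (@inl_inj _ _)) (negbTE ij).
  by case.
by move: md; rewrite {1}mE !mdegM !mdegU.
Qed.

(** Cancellation over any commutative ring: if x_i - x_j kills a polynomial, then by [mord_cancel]
    that polynomial has arbitrarily large order. *)
Lemma mulXB_inj i j f g : i != j ->
  (X R i - X R j) * f = (X R i - X R j) * g -> f = g.
Proof.
move=> ij fg; apply/eqP; rewrite -subr_eq0; apply/eqP/mord_inj => d.
by apply: (mord_cancel ij); rewrite mulrBr fg subrr; exact: mord_zero.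
Qed.

(** * The operators [swap] and [dpi] on polynomials *)

Lemma pol_rmorph_ext (phi psi : {rmorphism pol -> pol}) :
    (forall c : R, phi c%:MP = psi c%:MP) ->
    (forall k, phi (X R k) = psi (X R k)) ->
    (forall k, phi (T R k) = psi (T R k)) ->
  phi =1 psi.
Proof.
move=> eC eX eT; apply: pol_ind => [//|[k|k]|f g ff gg|f g ff gg].
- exact: eX.
- exact: eT.
- by rewrite (rmorphD phi) (rmorphD psi) ff gg.
- by rewrite (rmorphM phi) (rmorphM psi) ff gg.
Qed.

Lemma swapK i : involutive (@swap R i).
Proof.
apply: (pol_rmorph_ext (phi := @swap R i \o @swap R i) (psi := idfun)).
- by move=> c; rewrite /= !swapC.
- by move=> k; rewrite /= !swapX s_K.
- by move=> k; rewrite /= !swapT.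
Qed.

(** Quotients are explicit on constants and variables; the twisted Leibniz rule carries existence to
    products. *)
Lemma divdiff_exists i f : exists g, (X R i - X R i.+1) * g = f - swap i f.
Proof.
elim/pol_ind: f => [c|[k|k]|f g [f' ff] [g' gg]|f g [f' ff] [g' gg]].
- by exists 0; rewrite (swapC i c) mulr0 subrr.
- rewrite -/(X R k) (swapX i k) /s_; case: eqP => [->|_].
    by exists 1; rewrite mulr1.
  case: eqP => [->|_]; first by exists (-1); rewrite mulrN1 opprB.
  by exists 0; rewrite mulr0 subrr.
- by exists 0; rewrite -/(T R k) (swapT i k) mulr0 subrr.
- by exists (f' + g'); rewrite (mulrDr _ f' g') ff gg (swapD i f g) opprD addrACA.
exists (f' * g + swap i f * g'); rewrite (swapM i f g).
exact: (twisted_leibniz ff gg).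
Qed.

Lemma divdiffE i f : (X R i - X R i.+1) * divdiff i f = f - swap i f.
Proof. exact: (xgetPex 0 (divdiff_exists i f)). Qed.

Lemma dpiE i f : (X R i - X R i.+1) * dpi i f = X R i * f - X R i.+1 * swap i f.
Proof. by rewrite divdiffE (swapM i (X R i) f) swapX /s_ eqxx. Qed.

Lemma swap_swapX i j k : swap i (swap j (X R k)) = X R (s_ i (s_ j k)).
Proof. exact: etrans (congr1 (swap i) (swapX j k)) (swapX i _). Qed.

Lemma swap_swapT i j k : swap i (swap j (T R k)) = T R k.
Proof. exact: etrans (congr1 (swap i) (swapT j k)) (swapT i _). Qed.

Lemma swap_swapC i j (c : R) : swap i (swap j c%:MP) = c%:MP.
Proof. exact: etrans (congr1 (swap i) (swapC j c)) (swapC i _). Qed.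

Lemma swap_comm i j f : (i.+1 < j)%N -> swap i (swap j f) = swap j (swap i f).
Proof.
move=> ij; move: f.
apply: (pol_rmorph_ext (phi := @swap R i \o @swap R j) (psi := @swap R j \o @swap R i)).
- by move=> c; exact: etrans (swap_swapC _ _ _) (esym (swap_swapC _ _ _)).
- move=> k; apply: etrans (swap_swapX _ _ _) _; rewrite s_comm //.
  exact: esym (swap_swapX _ _ _).
- by move=> k; exact: etrans (swap_swapT _ _ _) (esym (swap_swapT _ _ _)).
Qed.

Lemma swap_braid i f :
  swap i (swap i.+1 (swap i f)) = swap i.+1 (swap i (swap i.+1 f)).
Proof.
move: f.
apply: (pol_rmorph_ext (phi := @swap R i \o @swap R i.+1 \o @swap R i)
  (psi := @swap R i.+1 \o @swap R i \o @swap R i.+1)).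
- move=> c; apply: etrans (congr1 (swap i) (swap_swapC _ _ _)) _.
  apply: etrans (swapC _ _) (esym _).
  exact: etrans (congr1 (swap i.+1) (swap_swapC _ _ _)) (swapC _ _).
- move=> k; apply: etrans (congr1 (swap i) (swap_swapX _ _ _)) _.
  apply: etrans (swapX _ _) (esym _).
  apply: etrans (congr1 (swap i.+1) (swap_swapX _ _ _)) _.
  by apply: etrans (swapX _ _) _; rewrite s_braid.
move=> k; apply: etrans (congr1 (swap i) (swap_swapT _ _ _)) _.
apply: etrans (swapT _ _) (esym _).
exact: etrans (congr1 (swap i.+1) (swap_swapT _ _ _)) (swapT _ _).
Qed.

Lemma dpi_zmod_morphism i : zmod_morphism (@dpi R i).
Proof. exact: (isobaric_zmod_morphism mulXB_inj dpiE). Qed.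

HB.instance Definition _ i :=
  GRing.isZmodMorphism.Build pol pol (@dpi R i) (dpi_zmod_morphism i).

Lemma dpiMr i f g : swap i g = g -> dpi i (f * g) = dpi i f * g.
Proof. exact: (isobaricMr mulXB_inj dpiE). Qed.

Lemma dpi_comm i j f : (i.+1 < j)%N -> dpi i (dpi j f) = dpi j (dpi i f).
Proof. exact: (isobaric_comm mulXB_inj swapX swap_comm dpiE). Qed.

Lemma dpi_braid i f :
  dpi i (dpi i.+1 (dpi i f)) = dpi i.+1 (dpi i (dpi i.+1 f)).
Proof. exact: (isobaric_braid mulXB_inj swapX swapK swap_braid dpiE). Qed.

(** The numerator gains one degree from x_i and x_{i+1}, and division by x_i - x_{i+1} loses it
    again. This lets congruences modulo high degree pass through pi_i. *)
Lemma mord_dpi d i f : mord d f -> mord d (dpi i f).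
Proof.
move=> fd; apply: (@mord_cancel _ i i.+1).
  by rewrite (ltn_eqF (ltnSn i)).
rewrite dpiE -add1n; apply: mordB; apply: mordM; try exact: mordX1; first exact: fd.
exact: mord_swap.
Qed.

End Polynomials.

(** * Reduced words *)

Section Words.
Implicit Types (a b c : seq nat) (i j k n : nat).

Lemma word_perm_inj a : injective (word_perm a).
Proof. by elim: a => //= i a IH; apply: inj_comp IH; exact: inv_inj (s_K i). Qed.

Lemma word_perm_surj a k : exists l, word_perm a l = k.
Proof.
elim: a k => [|i a IH] k /=; first by exists k.
by have [l lE] := IH (s_ i k); exists l; rewrite lE s_K.
Qed.

Lemma word_perm_bij a : bijective (word_perm a).
Proof.
elim: a => [|i a IH] /=; first by exists id.
by apply: bij_comp IH; exact: inv_bij (s_K i).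
Qed.

Lemma word_perm0 a : all (leq 1) a -> word_perm a 0 = 0%N.
Proof. by elim: a => //= i a IH /andP[i0 /IH ->]; rewrite s_id //; lia. Qed.

Definition transp k l x : nat := if x == k then l else if x == l then k else x.

(** The inversion (k, l) is created by some letter of the word. If that is the head i, the tail
    sends k to i and l to i+1, and deleting the head amounts to exchanging k and l beforehand;
    otherwise the inversion is already present in the tail. *)
Lemma strong_exchange a k l : (k < l)%N -> (word_perm a l < word_perm a k)%N ->
  exists b, [/\ size a = (size b).+1, all (leq 1) a -> all (leq 1) b &
    word_perm b =1 word_perm a \o transp k l].
Proof.
move=> kl; elim: a => [|i a IH] /=; first lia.
case: (ltngtP (word_perm a l) (word_perm a k)) => [lka|kla|/word_perm_inj]; last lia.
  move=> _; have [b [ab pb bE]] := IH lka.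
  exists (i :: b); split=> /= [|/andP[-> /pb //]|x]; first by rewrite ab.
  by rewrite /= bE.
move=> sa; have [ak al] : word_perm a k = i /\ word_perm a l = i.+1.
  by move: sa; rewrite /s_; repeat case: eqP => //; lia.
exists a; split=> // [/andP[] //|x] /=; rewrite /transp.
case: eqP => [->|xk]; first by rewrite al s_iS.
case: eqP => [->|xl]; first by rewrite ak s_i.
rewrite s_id //.
  by apply/eqP => xi; apply: xk; apply: (@word_perm_inj a); rewrite ak.
by apply/eqP => xi; apply: xl; apply: (@word_perm_inj a); rewrite al.
Qed.

(** Reducedness phrased by comparing words only, which is easier to manipulate than [ell];
    [reduced_minimal] links the two. *)
Definition minimal_word a := all (leq 1) a /\
  forall b, all (leq 1) b -> word_perm b =1 word_perm a -> (size a <= size b)%N.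

Lemma minimal_word_size a b : minimal_word a -> minimal_word b ->
  word_perm a =1 word_perm b -> size a = size b.
Proof.
move=> [pa am] [pb bm] ab; apply/eqP; rewrite eqn_leq (am b pb) ?(bm a pa) //.
Qed.

Lemma minimal_word_eq a b : minimal_word a -> all (leq 1) b ->
  word_perm b =1 word_perm a -> size b = size a -> minimal_word b.
Proof.
move=> [pa am] pb ba sab; split=> // c pc cb; rewrite sab; apply: am => // k.
by rewrite cb ba.
Qed.

Lemma minimal_word_behead i a : minimal_word (i :: a) -> minimal_word a.
Proof.
move=> [/= /andP[pi pa] am]; split=> // b pb ba.
rewrite -ltnS; apply: (am (i :: b)); first by rewrite /= pi.
by move=> k /=; rewrite ba.
Qed.

(** If the tail took the value i+1 before i, strong exchange would delete a letter of the tail and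
    give a word for s_i w two letters shorter than [i :: a], where w is the permutation of [a]. *)
Lemma minimal_word_ascent i a k l : minimal_word (i :: a) ->
  word_perm a k = i -> word_perm a l = i.+1 -> (k < l)%N.
Proof.
move=> [/= /andP[pi pa] am] ak al; case: ltngtP => // [lk|kl]; last first.
  by move: al; rewrite -kl ak; lia.
have [|b [ab pb bE]] := @strong_exchange a l k lk; first by rewrite ak al.
suff : (size (i :: a) <= size b)%N by rewrite /= ab; lia.
apply: (am b) => [|x]; first exact: pb.
rewrite bE /= /transp; case: eqP => [->|xl]; first by rewrite ak al s_iS.
case: eqP => [->|xk]; first by rewrite ak al s_i.
rewrite s_id //.
  by apply/eqP => xi; apply: xk; apply: (@word_perm_inj a); rewrite ak.
by apply/eqP => xi; apply: xl; apply: (@word_perm_inj a); rewrite al.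
Qed.

(** Strong exchange at the inversion formed by the values i+1 and i: it shows that a left descent i
    can be moved to the head of a minimal word. *)
Lemma minimal_word_descent i a k l : (0 < i)%N -> minimal_word a -> (k < l)%N ->
    word_perm a k = i.+1 -> word_perm a l = i ->
  exists b, [/\ minimal_word b, minimal_word (i :: b), size a = (size b).+1 &
    word_perm b =1 s_ i \o word_perm a].
Proof.
move=> i0 ma kl ak al.
have [|b [ab pb bE]] := @strong_exchange a k l kl; first by rewrite ak al.
have bE' : word_perm b =1 s_ i \o word_perm a.
  move=> x; rewrite bE /= /transp; case: eqP => [->|xk]; first by rewrite ak al s_iS.
  case: eqP => [->|xl]; first by rewrite ak al s_i.
  rewrite s_id //.
    by apply/eqP => xi; apply: xl; apply: (@word_perm_inj a); rewrite al.
  by apply/eqP => xi; apply: xk; apply: (@word_perm_inj a); rewrite ak.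
have mb : minimal_word (i :: b).
  apply: (minimal_word_eq ma) => [|x|] /=; rewrite ?i0 ?ab //.
    by apply: pb; case: ma.
  by rewrite bE' /= s_K.
by exists b; split=> //; exact: minimal_word_behead mb.
Qed.

Lemma minimal_word_in_S n i a : minimal_word (i :: a) ->
  in_S n (word_perm (i :: a)) -> in_S n (word_perm a) /\ (0 < i < n)%N.
Proof.
move=> ma [_ _ fixn]; have [/= /andP[i0 pa] _] := ma.
have [k ak] := word_perm_surj a i; have [l al] := word_perm_surj a i.+1.
have kl := minimal_word_ascent ma ak al.
(* If n <= i, then i+1 is a fixed point, so k = i+1; then l > k is also fixed, yet its image is
   i. *)
have iE : (i < n)%N.
  rewrite ltnNge; apply/negP => ni.
  have kE : k = i.+1.
    by apply: (@word_perm_inj (i :: a)); rewrite (fixn i.+1) ?ltnS //= ak s_i.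
  have nl : (n < l)%N by lia.
  by have := fixn l nl; rewrite /= al s_iS; lia.
split; last by rewrite i0.
split=> [||k' nk']; [exact: word_perm_bij|exact: word_perm0|].
by rewrite -[LHS](s_K i) [X in s_ i X](fixn k' nk') s_id; lia.
Qed.

Lemma ell_leq w a : all (leq 1) a -> word_perm a =1 w -> (ell w <= size a)%N.
Proof.
move=> pa aw; rewrite /ell.
have ex : exists m, `[< has_word w m >].
  by exists (size a); apply/asboolP; exists a.
case: (ex_minnP ex) => m /asboolP wm mmin.
(* The set defining [ell] is inhabited, so [xget] does not fall back on the default 0. *)
have Pm : [set m | has_word w m /\ forall k, has_word w k -> (m <= k)%N]%classic m.
  by split=> // k wk; apply: mmin; exact/asboolP.
by have [_] := xgetI 0%N Pm; apply; exists a.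
Qed.

Lemma reduced_minimal a : reduced a -> minimal_word a.
Proof.
elim: a => [|i a IH] //= [i0 /IH[pa _] aE]; split; first by rewrite /= i0.
by move=> b pb ba; rewrite /= -aE; apply: ell_leq pb _.
Qed.

(** Matsumoto's theorem, by induction on the length. If the head letters i and j differ, both are
    left descents of the permutation, which therefore has minimal words starting with the two sides
    of the commutation or braid relation for i and j and ending alike. The induction hypothesis on
    the tails connects the given words with these. *)
Lemma minimal_word_braid_eq (A : Type) (p : nat -> A -> A) a b :
    (forall i j f, (i.+1 < j)%N -> p i (p j f) = p j (p i f)) ->
    (forall i f, p i (p i.+1 (p i f)) = p i.+1 (p i (p i.+1 f))) ->
    minimal_word a -> minimal_word b -> word_perm a =1 word_perm b ->
  forall f, foldr p f a = foldr p f b.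
Proof.
move=> pcomm pbraid; move: {2}(size a) (leqnn (size a)) => n.
elim: n a b => [|n IH] [|i a] [|j b] //= sa ma mb ab.
- by have := minimal_word_size ma mb ab.
- by have := minimal_word_size ma mb ab.
- by have := minimal_word_size ma mb ab.
have sb : (size b <= n)%N by case: (minimal_word_size ma mb ab) => <-.
(* By symmetry, distinct head letters may be taken in increasing order. *)
have key i' j' a' b' : (i' < j')%N -> minimal_word (i' :: a') ->
    minimal_word (j' :: b') -> word_perm (i' :: a') =1 word_perm (j' :: b') ->
    (size a' <= n)%N -> (size b' <= n)%N ->
    forall f, p i' (foldr p f a') = p j' (foldr p f b').
  move: i' j' a' b' => {i j a b sa ma mb ab sb} i j a b ij ma mb ab sa sb f.
  have [[/andP[i0 _] _] [/andP[j0 _] _]] := (ma, mb).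
  have [k ak] := word_perm_surj a i; have [k' ak'] := word_perm_surj a i.+1.
  have [l bl] := word_perm_surj b j; have [l' bl'] := word_perm_surj b j.+1.
  have kk' := minimal_word_ascent ma ak ak'; have ll' := minimal_word_ascent mb bl bl'.
  have aE x : word_perm a x = s_ i (s_ j (word_perm b x)).
    by have /= <- := ab x; rewrite s_K.
  have bE x : word_perm b x = s_ j (s_ i (word_perm a x)).
    by have /= -> := ab x; rewrite s_K.
  have sab : size a = size b by case: (minimal_word_size ma mb ab).
  have [ma' mb'] := (minimal_word_behead ma, minimal_word_behead mb).
  have [iSj|iSj] := ltnP i.+1 j.
    (* Commuting letters: [c] is a common remainder, [a] being equivalent to [j :: c] and [b] to
       [i :: c]. *)
    have al : word_perm a l = j.+1 by rewrite aE bl s_i s_id; lia.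
    have al' : word_perm a l' = j by rewrite aE bl' s_iS s_id; lia.
    have [c [mc mjc ac cE]] := minimal_word_descent j0 ma' ll' al al'.
    have mic : minimal_word (i :: c).
      apply: (minimal_word_eq mb') => [|x|] /=; last by rewrite -sab ac.
        by rewrite i0; case: mc.
      by rewrite cE bE /= (s_comm _ iSj).
    rewrite (IH a (j :: c)) //=; last by move=> x; rewrite /= cE /= s_K.
    rewrite (IH b (i :: c)) //=; first exact: pcomm.
    by move=> x; rewrite /= cE bE /= (s_comm _ iSj).
  have jE : j = i.+1 by lia.
  move: ij jE bl bl' aE bE mb ab j0 {iSj} => _ -> bl bl' aE bE mb ab j0.
  (* Adjacent letters: [a] takes the values i+2, i, i+1 at the positions l < l' = k < k', so the
     letters i+1 and then i split off, leaving the common remainder [d]. *)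
  have al : word_perm a l = i.+2 by rewrite aE bl s_i s_id; lia.
  have al' : word_perm a l' = i by rewrite aE bl' s_iS s_iS.
  have l'E : l' = k by apply: (@word_perm_inj a); rewrite al' ak.
  have lk' : (l < k')%N by lia.
  have [c [mc mjc ac cE]] := minimal_word_descent j0 ma' lk' al ak'.
  have cl : word_perm c l = i.+1 by rewrite cE /= al s_iS.
  have cl' : word_perm c l' = i by rewrite cE /= al' s_id; lia.
  have [d [md mid cd dE]] := minimal_word_descent i0 mc ll' cl cl'.
  have aE' : word_perm [:: i.+1, i & d] =1 word_perm a.
    by move=> x; rewrite /= dE /= s_K cE /= s_K.
  have bE' : word_perm [:: i, i.+1 & d] =1 word_perm b.
    by move=> x; rewrite /= dE /= cE /= s_braid s_K bE.
  have pd : all (leq 1) d by case: md.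
  have maa : minimal_word [:: i.+1, i & d].
    by apply: (minimal_word_eq ma' _ aE'); rewrite /= ?i0 // -cd ac.
  have mbb : minimal_word [:: i, i.+1 & d].
    by apply: (minimal_word_eq mb' _ bE'); rewrite /= ?i0 // -cd -ac.
  rewrite (IH a [:: i.+1, i & d]) //.
  rewrite (IH b [:: i, i.+1 & d]) //.
  exact: pbraid.
move=> f; have [ij|ij|ij] := ltngtP i j.
- exact: key.
- apply/esym; apply: key => // x; exact/esym/ab.
move: ab ma mb; rewrite ij => ab ma mb; congr (p j _); apply: IH => //.
- exact: minimal_word_behead ma.
- exact: minimal_word_behead mb.
by move=> x; have /= /(inv_inj (s_K j)) := ab x.
Qed.

End Words.

(** * The sets A_l *)

Section AdmissibleSequences.
Implicit Types (alpha beta s : seq nat) (i j k l n : nat).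

Definition count_le k s := count (fun x => x <= k)%N s.

Lemma nth_leE s j k : sorted leq s -> (j < size s)%N ->
  (nth 0 s j <= k)%N = (j < count_le k s)%N.
Proof.
elim: s j => // x s IH j xs js.
have [xk|kx] := leqP x k.
  rewrite /count_le /= xk; case: j js => [|j] js //=.
  by rewrite IH //; exact: path_sorted xs.
have -> : count_le k (x :: s) = 0%N.
  apply/eqP; rewrite -leqn0 leqNgt -has_count -all_predC.
  have := order_path_min leq_trans xs; rewrite /= -ltnNge kx /=; apply: sub_all => y xy.
  by rewrite /= -ltnNge (leq_trans kx).
apply/negbTE; rewrite -ltnNge; case: j js => [|j] //= js.
by have /(all_nthP 0%N)/(_ j js) := order_path_min leq_trans xs; exact: leq_trans.
Qed.

(** By [nth_leE], an entry is at most k exactly when its index is below the count of entries at most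
    k. Counts need no sorting and change under s_i in one place only, hence this reformulation. *)
Lemma le_nth_countP alpha beta l : sorted leq alpha -> sorted leq beta ->
    size alpha = l -> size beta = l ->
  (forall j, (j < l)%N -> (nth 0 alpha j <= nth 0 beta j)%N) <->
  (forall k, (count_le k beta <= count_le k alpha)%N).
Proof.
move=> sa sb al bl; split=> [ab k|ab j jl].
  case E : (count_le k beta) => [|j] //.
  have jl : (j < l)%N by rewrite -bl -E count_size.
  rewrite -nth_leE ?al // (leq_trans (ab j jl)) // nth_leE ?bl //.
  by rewrite E.
by rewrite nth_leE ?al // (leq_trans _ (ab _)) // -nth_leE ?bl.
Qed.

Lemma ltn_sorted_leq s : sorted ltn s -> sorted leq s.
Proof. by rewrite ltn_sorted_uniq_leq => /andP[]. Qed.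

Lemma count_le_sort k s : count_le k (sort leq s) = count_le k s.
Proof. by apply/permP; rewrite perm_sort. Qed.

Lemma A_P l w alpha : A_ l w alpha <->
  [/\ size alpha = l, all (leq 1) alpha, sorted ltn alpha &
    forall k, (count_le k (map w (iota 1 l)) <= count_le k alpha)%N].
Proof.
have sw : size (wsort l w) = l by rewrite /wsort size_sort size_map size_iota.
have ww : sorted leq (wsort l w) by apply: sort_sorted; exact: leq_total.
split=> -[al pa sa].
  move=> /(le_nth_countP (ltn_sorted_leq sa) ww al sw) h.
  by split=> // k; rewrite -count_le_sort; exact: h.
move=> h; split=> //; apply/(le_nth_countP (ltn_sorted_leq sa) ww al sw) => k.
by rewrite count_le_sort.
Qed.

Lemma count_le_split i s : count_le i s = (count (ltn^~ i) s + count_mem i s)%N.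
Proof.
elim: s => //= x s ->; rewrite addnACA; congr (_ + _)%N.
by case: (ltngtP x i).
Qed.

Lemma count_leS i s : count_le i.+1 s = (count_le i s + count_mem i.+1 s)%N.
Proof. exact: count_le_split. Qed.

Lemma count_le_s i k s : k != i -> count_le k (map (s_ i) s) = count_le k s.
Proof.
move=> ki; rewrite /count_le count_map; apply: eq_count => x /=.
by rewrite /s_; case: eqP => [->|_]; [|case: eqP => [->|] //]; lia.
Qed.

Lemma count_le_si i s :
  count_le i (map (s_ i) s) = (count (ltn^~ i) s + count_mem i.+1 s)%N.
Proof.
rewrite /count_le count_map; elim: s => //= x s ->.
rewrite addnACA; congr (_ + _)%N; rewrite /s_.
by case: eqP => [->|]; [|case: eqP => [->|] //]; rewrite ?eqxx; lia.
Qed.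

Lemma size_s_seq i alpha : size (s_seq i alpha) = size alpha.
Proof. by rewrite /s_seq size_sort size_map. Qed.

Lemma count_le_s_seq i k alpha :
  count_le k (s_seq i alpha) = count_le k (map (s_ i) alpha).
Proof. exact: count_le_sort. Qed.

Lemma s_seq_pos i alpha : (0 < i)%N -> all (leq 1) alpha -> all (leq 1) (s_seq i alpha).
Proof.
move=> i0; rewrite /s_seq all_sort all_map; apply: sub_all => x /= x0.
by rewrite /s_; repeat case: ifP => _ //; lia.
Qed.

Lemma s_seq_sorted i alpha : sorted ltn alpha -> sorted ltn (s_seq i alpha).
Proof.
move=> sa; rewrite ltn_sorted_uniq_leq sort_sorted ?andbT; last exact: leq_total.
rewrite sort_uniq map_inj_uniq; last exact: inv_inj (s_K i).
exact: sorted_uniq ltn_trans ltnn _ sa.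
Qed.

Lemma s_seqK i alpha : sorted ltn alpha -> s_seq i (s_seq i alpha) = alpha.
Proof.
move=> sa; apply: (sorted_eq leq_trans anti_leq).
- by apply: sort_sorted; exact: leq_total.
- exact: ltn_sorted_leq.
rewrite /s_seq perm_sort; apply: perm_trans (perm_map _ _) _.
  by rewrite perm_sort; exact: perm_refl.
by rewrite -map_comp map_id_in // => x _; exact: s_K.
Qed.

Lemma finite_A_ l w : finite_set (A_ l w).
Proof.
pose M := (\max_(x <- wsort l w) x).+1.
apply: (@sub_finite_set _ _ ((fun t : l.-tuple 'I_M => [seq val x | x <- t]) @` setT)%classic);
  last exact/finite_image/finite_finset.
move=> alpha [al pa sa h].
have aM x : x \in alpha -> (x < M)%N.
  move=> /(nthP 0%N)[j jl <-]; rewrite ltnS; rewrite al in jl.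
  apply: leq_trans (h j jl) _; apply: (@leq_bigmax_seq _ _ xpredT id) => //.
  by rewrite mem_nth // /wsort size_sort size_map size_iota.
have sz : size [seq insubd (Ordinal (ltn0Sn _)) x : 'I_M | x <- alpha] == l.
  by rewrite size_map al.
exists (Tuple sz) => //=; rewrite -map_comp map_id_in // => x /aM xM.
by rewrite /= val_insubd xM.
Qed.

Section Ascent.
Variables (i : nat) (a : seq nat) (l : nat).
Hypothesis ia : minimal_word (i :: a).
Local Notation w := (word_perm a).
Local Notation w' := (word_perm (i :: a)).

Let i0 : (0 < i)%N. Proof. by case: ia => /andP[]. Qed.
Let B := map w (iota 1 l).

Let uniqB : uniq B.
Proof. by rewrite map_inj_uniq ?iota_uniq //; exact: word_perm_inj. Qed.

(** In w the value i stands before i+1, so whenever i+1 is among the first l values, i is too. *)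
Let B_ascent : (count_mem i.+1 B <= count_mem i B)%N.
Proof.
rewrite !count_uniq_mem //; case: (boolP (i.+1 \in B)) => // /mapP[q ql qi].
have [p pi] := word_perm_surj a i.
have pq : (p < q)%N by apply: (minimal_word_ascent ia pi).
have p0 : p != 0%N.
  by apply/eqP => p0; move: pi i0; rewrite p0 word_perm0 => [<-|] //; case: ia => /andP[].
suff -> : i \in B by [].
by rewrite -pi; apply: map_f; move: ql; rewrite !mem_iota; lia.
Qed.

Let count_le_i s : uniq s -> count_le i s = (count_le i.-1 s + (i \in s))%N.
Proof.
move=> us; rewrite count_le_split count_uniq_mem //; congr (_ + _)%N.
by apply: eq_count => x /=; lia.
Qed.

Let count_le_w' k : count_le k (map w' (iota 1 l)) =
  if k == i then (count_le i.-1 B + (i.+1 \in B))%N else count_le k B.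
Proof.
have -> : map w' (iota 1 l) = map (s_ i) B by rewrite -map_comp.
case: eqP => [->|/eqP ki]; last exact: count_le_s.
rewrite count_le_si count_uniq_mem //; congr (_ + _)%N.
by apply: eq_count => x /=; lia.
Qed.

Let count_le_s_alpha k alpha : sorted ltn alpha -> count_le k (s_seq i alpha) =
  if k == i then (count_le i.-1 alpha + (i.+1 \in alpha))%N else count_le k alpha.
Proof.
move=> sa; rewrite count_le_s_seq; case: eqP => [->|/eqP ki]; last exact: count_le_s.
rewrite count_le_si count_uniq_mem; last exact: sorted_uniq ltn_trans ltnn _ sa.
by congr (_ + _)%N; apply: eq_count => x /=; lia.
Qed.

(* Only the count of entries at most i is affected by s_i, on either side. *)
Lemma A_s_wordP alpha : sorted ltn alpha ->
  A_ l w' alpha <-> A_ l w alpha \/ A_ l w (s_seq i alpha).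
Proof.
move=> sa; have ua := sorted_uniq ltn_trans ltnn sa.
have ii : i.-1 != i by lia.
have iSi : i.+1 != i by lia.
have count_iS s : uniq s ->
    count_le i.+1 s = (count_le i.-1 s + (i \in s) + (i.+1 \in s))%N.
  by move=> us; rewrite count_leS count_le_i // count_uniq_mem.
have B1 : ((i.+1 \in B) <= (i \in B))%N by rewrite -!count_uniq_mem.
split=> [/A_P[al pa _ h]|].
  have hk k : k != i -> (count_le k B <= count_le k alpha)%N.
    by move=> ki; have := h k; rewrite count_le_w' (negbTE ki).
  have [hi|hi] := leqP (count_le i B) (count_le i alpha).
    left; apply/A_P; split=> // k; have [->//|ki] := eqVneq k i; exact: hk.
  right; apply/A_P; split=> [|||k]; [by rewrite size_s_seq|exact: s_seq_pos|
    exact: s_seq_sorted|].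
  rewrite count_le_s_alpha //; case: eqP => [->|/eqP]; last exact: hk.
  (* The bound for w fails at i and the one for s_i w holds, so [B] contains i but not i+1. The
     bounds at i-1 and i+1 then force i+1 into [alpha] and i out of it, and s_i repairs the count at
     i. *)
  move: hi (h i) (hk _ ii) (hk _ iSi) B1; rewrite count_le_w' eqxx -/B !count_le_i //.
  rewrite !count_iS //.
  by case: (i \in B); case: (i.+1 \in B); case: (i \in alpha); case: (i.+1 \in alpha) => /=; lia.
case=> [/A_P[al pa _ h]|/A_P[]].
  apply/A_P; split=> // k; rewrite count_le_w'; case: eqP => [->|_]; last exact: h.
  by apply: leq_trans (h i); rewrite -/B count_le_i // leq_add2l.
rewrite size_s_seq => al /(s_seq_pos i0); rewrite s_seqK // => pa _ h.
have hk k : k != i -> (count_le k B <= count_le k alpha)%N.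
  by move=> ki; have := h k; rewrite count_le_s_alpha // (negbTE ki).
apply/A_P; split=> // k; rewrite count_le_w'; case: eqP => [->|/eqP]; last exact: hk.
move: (h i) (hk _ ii) (hk _ iSi) B1; rewrite count_le_s_alpha // eqxx -/B !count_le_i //.
rewrite !count_iS //.
by case: (i \in B); case: (i.+1 \in B); case: (i \in alpha); case: (i.+1 \in alpha) => /=; lia.
Qed.

Lemma A_s_word :
  A_ l w' = (A_ l w `|` s_seq i @` Ai_ l i w)%classic.
Proof.
apply/seteqP; split=> alpha /=.
  move=> Aa; have sa : sorted ltn alpha by case: Aa.
  have [Aw|nAw] := pselect (A_ l w alpha); first by left.
  right; exists (s_seq i alpha); last exact: s_seqK.
  by split; [case/(A_s_wordP sa): Aa|rewrite s_seqK].
case=> [Aa|[beta [Ab _] <-]].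
  by apply/A_s_wordP; [case: Aa|left].
have sb : sorted ltn beta by case: Ab.
by apply/A_s_wordP; [exact: s_seq_sorted|right; rewrite s_seqK].
Qed.

Lemma A_s_word_stable alpha : A_ l w' alpha -> A_ l w' (s_seq i alpha).
Proof.
move=> Aa; have sa : sorted ltn alpha by case: Aa.
apply/A_s_wordP; first exact: s_seq_sorted.
by rewrite s_seqK //; have /(A_s_wordP sa)[] := Aa; [right|left].
Qed.

(** The count of [B] at i is one less than at i+1, while for s_i alpha the count drops by at most
    one between these places; so the bound at i+1 implies the bound at i. *)
Lemma Ai_eq0 : i \in B -> i.+1 \in B -> Ai_ l i w = set0.
Proof.
move=> iB iSB; apply/seteqP; split=> // alpha [/A_P[al pa sa h]]; apply.
have ua := sorted_uniq ltn_trans ltnn sa.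
apply/A_P; split=> [|||k]; [by rewrite size_s_seq|exact: s_seq_pos|
  exact: s_seq_sorted|].
rewrite count_le_s_alpha //; case: eqP => [->|/eqP //].
have := h i.+1; rewrite !count_leS !count_uniq_mem // -/B iSB !count_le_i // iB.
by case: (i \in alpha); case: (i.+1 \in alpha) => /=; lia.
Qed.

(** For l >= n the first l values of w include 1, ..., n, hence both i and i+1 because i < n. So
    N_{w,i} is a finite product. *)
Lemma Ai_large n : in_S n w' -> (n <= l)%N -> Ai_ l i w = set0.
Proof.
move=> wn nl; have [[_ w0 fixn] /andP[_ ni]] := minimal_word_in_S ia wn.
have inB k : (0 < k <= n)%N -> k \in B.
  move=> kn; have [p pk] := word_perm_surj a k.
  have p0 : p != 0%N by apply/eqP => p0; move: pk; rewrite p0 w0; lia.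
  have pn : (p <= n)%N.
    by rewrite leqNgt; apply/negP => np; move: pk; rewrite fixn //; lia.
  by rewrite -pk; apply: map_f; rewrite mem_iota; lia.
by apply: Ai_eq0; apply: inB; lia.
Qed.

Section Products.
Variables (A : comNzRingType) (F : seq nat -> A).

Lemma prod_A_s_word :
  \big[*%R/1]_(alpha \in A_ l w') F alpha =
  \big[*%R/1]_(alpha \in A_ l w) F alpha *
  \big[*%R/1]_(alpha \in Ai_ l i w) F (s_seq i alpha).
Proof.
have inj : set_inj (Ai_ l i w) (s_seq i).
  move=> alpha beta /set_mem[[_ _ sa _] _] /set_mem[[_ _ sb _] _] ab.
  by rewrite -(s_seqK i sa) ab s_seqK.
have fAi : finite_set (Ai_ l i w).
  by apply: sub_finite_set (finite_A_ l w) => alpha [].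
rewrite A_s_word fsbigU0.
- by rewrite fsbig_image.
- exact: finite_A_.
- exact: finite_image.
by move=> alpha /= [Aa [beta [_ nb] ba]]; apply: nb; rewrite ba.
Qed.

(** The map [s_seq i] is an involution of A_l(s_i w), so the product is only reindexed. *)
Lemma prod_A_s_word_sym :
  \big[*%R/1]_(alpha \in A_ l w') F (s_seq i alpha) =
  \big[*%R/1]_(alpha \in A_ l w') F alpha.
Proof.
apply/esym/reindex_fsbig; split.
- by move=> alpha /= /A_s_word_stable.
- move=> alpha beta /set_mem[_ _ sa _] /set_mem[_ _ sb _] ab.
  by rewrite -(s_seqK i sa) ab s_seqK.
move=> alpha Aa; exists (s_seq i alpha); first exact: A_s_word_stable.
by apply: s_seqK; case: Aa.
Qed.

End Products.
End Ascent.

(** Strict increase from a positive first entry forces alpha_j >= j, which meets the upper bound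
    j. *)
Lemma A_id l : A_ l id = [set iota 1 l]%classic.
Proof.
have wE : wsort l id = iota 1 l.
  rewrite /wsort map_id; apply: sorted_sort; first exact: leq_trans.
  exact: iota_sorted.
apply/seteqP; split=> alpha /=; rewrite /A_ /= wE.
  move=> [al pa sa h]; apply: (@eq_from_nth _ 0%N) => [|j]; first by rewrite size_iota.
  rewrite al => jl; apply/eqP; rewrite eqn_leq h //= nth_iota // add1n.
  elim: j jl => [|j IH] jl.
    by have /(all_nthP 0%N)/(_ 0%N) := pa; rewrite al; apply.
  apply: leq_ltn_trans (IH (ltnW jl)) _.
  have /(sortedP 0%N)/(_ j) := sa; rewrite al; exact.
move=> ->; split=> //; first by rewrite size_iota.
  by apply/allP => x; rewrite mem_iota; lia.
exact: iota_ltn_sorted.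
Qed.

End AdmissibleSequences.

(** * Partitions *)

Section AdmissibleProducts.
Variables (A : comNzRingType) (F : nat -> seq nat -> A).
Variables (n i : nat) (a : seq nat).
Hypotheses (ia : minimal_word (i :: a)) (nia : in_S n (word_perm (i :: a))).

Lemma prod_denom_step :
  \prod_(1 <= l < n.+1) \big[*%R/1]_(alpha \in A_ l (word_perm (i :: a))) F l alpha =
  (\prod_(1 <= l < n.+1) \big[*%R/1]_(alpha \in A_ l (word_perm a)) F l alpha) *
  \big[*%R/1]_(l \in [set l | (0 < l)%N]%classic)
    \big[*%R/1]_(alpha \in Ai_ l i (word_perm a)) F l (s_seq i alpha).
Proof.
rewrite -(@fsbig_widen _ _ _ _ [set` index_iota 1 n.+1]) /=.
- rewrite -fsbig_seq ?iota_uniq // -big_split /=; apply: eq_bigr => l _.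
  exact: prod_A_s_word.
- by move=> l /=; rewrite mem_index_iota => /andP[].
move=> l [/= l0]; rewrite mem_index_iota l0 /= ltnS => /negP; rewrite -ltnNge => nl.
by rewrite (Ai_large ia nia (ltnW nl)) fsbig_set0.
Qed.

Lemma prod_denom_sym (phi : {rmorphism A -> A}) :
    (forall l alpha, phi (F l alpha) = F l (s_seq i alpha)) ->
  phi (\prod_(1 <= l < n.+1)
         \big[*%R/1]_(alpha \in A_ l (word_perm (i :: a))) F l alpha) =
  \prod_(1 <= l < n.+1) \big[*%R/1]_(alpha \in A_ l (word_perm (i :: a))) F l alpha.
Proof.
move=> phiF; rewrite rmorph_prod; apply: eq_bigr => l _.
rewrite -[RHS]prod_A_s_word_sym // !fsbig_finite; try exact: finite_A_.
by rewrite rmorph_prod; apply: eq_bigr => alpha _; exact: phiF.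
Qed.

End AdmissibleProducts.

(** * Partitions of bounded size and removal of full columns *)

Section Partitions.
Implicit Types (lam mu : seq nat) (n d k : nat).

Definition parts n d : set (seq nat) :=
  [set lam | [/\ is_partition lam, (size lam <= n)%N & (sumn lam <= d)%N]]%classic.

Lemma finite_parts n d : finite_set (parts n d).
Proof.
elim: n => [|n IH].
  apply: (@sub_finite_set _ _ [set [::]]%classic); last exact: finite_set1.
  by move=> lam [_]; rewrite leqn0 size_eq0 => /eqP ->.
apply: (@sub_finite_set _ _
  ([set [::]] `|` (fun p => p.1 :: p.2) @` (`I_d.+1 `*` parts n d))%classic).
  case=> [|x lam]; first by left.
  move=> [[/= slam /andP[x0 plam]] nlam dlam].
  right; exists (x, lam) => //=; split; first by rewrite /= ltnS; lia.
  by split=> //=; [split=> //; exact: path_sorted slam|lia].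
rewrite finite_setU; split; first exact: finite_set1.
by apply: finite_image; apply: finite_setX => //; exact: finite_II.
Qed.

Lemma size_le_sumn lam : all (leq 1) lam -> (size lam <= sumn lam)%N.
Proof. by elim: lam => //= x lam IH /andP[x0 /IH]; lia. Qed.

(** For at most [m] parts, this puts a column of height [m] in front of the Young diagram; missing
    parts are read as the default 0. *)
Definition add_column m lam := mkseq (fun k => (nth 0 lam k).+1) m.

Lemma sorted_geq_nth lam j k : sorted geq lam -> (j <= k)%N ->
  (nth 0 lam k <= nth 0 lam j)%N.
Proof.
move=> sl jk; have [kl|lk] := ltnP k (size lam); last by rewrite nth_default.
have geq_trans : transitive geq by move=> x y z /= xy yz; exact: leq_trans yz xy.
apply: (sorted_leq_nth geq_trans _ 0%N sl) => //; first exact: leqnn.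
by rewrite inE (leq_ltn_trans jk).
Qed.

Lemma add_column_partition m lam : is_partition lam -> is_partition (add_column m lam).
Proof.
move=> [sl pl]; split; last by apply/allP => x /mapP[k _ ->].
apply/(sortedP 0%N) => j; rewrite size_mkseq => jm.
by rewrite !nth_mkseq ?(ltnW jm) //= ltnS; exact: sorted_geq_nth.
Qed.

Lemma sumn_nth lam m : (size lam <= m)%N -> sumn lam = (\sum_(k < m) nth 0 lam k)%N.
Proof.
move=> lm; rewrite sumnE (big_nth 0%N) -(big_mkord xpredT (nth 0 lam)) /=.
rewrite [RHS](big_cat_nat (leq0n _) lm) /= [X in (_ + X)%N](_ : _ = 0%N) ?addn0 //.
by rewrite big_nat; apply: big1 => k /andP[lk _]; rewrite nth_default.
Qed.

Lemma sumn_add_column m lam : (size lam <= m)%N ->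
  sumn (add_column m lam) = (sumn lam + m)%N.
Proof.
move=> lm; rewrite (sumn_nth lm) (@sumn_nth _ m) ?size_mkseq //.
rewrite -[X in (_ + X)%N]card_ord -sum1_card -big_split /=.
by apply: eq_bigr => k _; rewrite nth_mkseq // addn1.
Qed.

Lemma nth_filter_pos lam k : sorted geq lam ->
  nth 0 [seq x <- lam | (0 < x)%N] k = nth 0%N lam k.
Proof.
elim: lam k => //= x lam IH k sl; case: (posnP x) => [x0|x0] /=; last first.
  by case: k => //= k; apply: IH; exact: path_sorted sl.
have lam0 j : nth 0 lam j = 0%N.
  by have := @sorted_geq_nth (x :: lam) 0 j.+1 sl isT; rewrite /= x0 leqn0 => /eqP.
by rewrite IH ?(path_sorted sl) // lam0; case: k => [|k] //=; rewrite lam0.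
Qed.

Lemma add_column_inj m : set_inj
  [set lam | is_partition lam /\ (size lam <= m)%N]%classic (add_column m).
Proof.
move=> lam mu /set_mem[[sl pl] lm] /set_mem[[sm pm] mm] lam_mu.
have nthE k : nth 0 lam k = nth 0 mu k.
  have [km|mk] := ltnP k m; last by rewrite !nth_default // (leq_trans _ mk).
  by have := congr1 (fun s => nth 0 s k) lam_mu; rewrite !nth_mkseq // => -[].
have pos s k : all (leq 1) s -> (k < size s)%N = (0 < nth 0 s k)%N.
  move=> /(all_nthP 0%N) ps; have [/ps //|sk] := ltnP k (size s).
  by rewrite nth_default.
have szE : size lam = size mu.
  have h k : (k < size lam)%N = (k < size mu)%N by rewrite !pos // nthE.
  by have := h (size lam); have := h (size mu); rewrite !ltnn; lia.
by apply: (@eq_from_nth _ 0%N).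
Qed.

(** A partition with exactly n+1 parts has a full first column, and removing it lowers the size by
    n+1. *)
Lemma partsS n d : (n < d)%N ->
  parts n.+1 d = (parts n d `|` add_column n.+1 @` parts n.+1 (d - n.+1))%classic.
Proof.
move=> nd; apply/seteqP; split=> lam /=; last first.
  case=> [[plam nlam dlam]|[mu [pmu nmu dmu] <-]]; first by split=> //; exact: leqW.
  split; [exact: add_column_partition|by rewrite size_mkseq|].
  by rewrite sumn_add_column //; lia.
move=> [plam nlam dlam]; have [ln|ln] := leqP (size lam) n; first by left.
have lE : size lam = n.+1 by lia.
have [slam poslam] := plam.
(* The parts equal to 1 become zeros and are dropped, as partitions list nonzero parts only. *)
pose mu := [seq x <- map predn lam | (0 < x)%N].
have smap : sorted geq (map predn lam).
  by apply: homo_sorted slam => x y /=; lia.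
have nthmu k : nth 0 mu k = (nth 0 lam k).-1.
  rewrite nth_filter_pos //; have [kl|lk] := ltnP k (size lam).
    by rewrite (nth_map 0%N).
  by rewrite !nth_default ?size_map.
have nmu : (size mu <= n.+1)%N.
  by rewrite /mu size_filter -lE -(size_map predn lam) count_size.
have lamE : add_column n.+1 mu = lam.
  apply: (@eq_from_nth _ 0%N); rewrite size_mkseq // => k kn.
  rewrite nth_mkseq // nthmu prednK //.
  by apply: (all_nthP 0%N poslam); rewrite lE.
right; exists mu => //; split=> //.
  split; last by apply/allP => x; rewrite mem_filter => /andP[].
  apply: sorted_filter smap => x y z /= xy yz; exact: leq_trans yz xy.
by move: dlam; rewrite -lamE sumn_add_column //; lia.
Qed.

Lemma parts_add_column_disjoint n d :
  (parts n d `&` add_column n.+1 @` parts n.+1 (d - n.+1) `<=` set0)%classic.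
Proof.
by move=> lam [[_ ln _] [mu _ lamE]]; move: ln; rewrite -lamE size_mkseq ltnn.
Qed.

Lemma parts_small n d : (d <= n)%N -> parts n.+1 d = parts n d.
Proof.
move=> dn; apply/seteqP; split=> lam [[sl pl] nl dl]; split=> //; last exact: leqW.
exact: leq_trans (size_le_sumn pl) (leq_trans dl dn).
Qed.

Section PartitionMonomials.
Variable A : comNzRingType.
Implicit Type z : nat -> A.

(** The common form of [xpart] and [tpart], which are its instances at [X R] and [T R]. *)
Definition partmon z lam : A := \prod_(k < size lam) z k.+1 ^+ nth 0%N lam k.

Lemma partmonE z lam m : (size lam <= m)%N ->
  partmon z lam = \prod_(k < m) z k.+1 ^+ nth 0%N lam k.
Proof.
move=> lm; rewrite /partmon -!(big_mkord xpredT (fun k => z k.+1 ^+ nth 0%N lam k)).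
rewrite [RHS](big_cat_nat (leq0n _) lm) /= [X in _ = _ * X](_ : _ = 1) ?mulr1 //.
by rewrite big_nat; apply: big1 => k /andP[lk _]; rewrite nth_default.
Qed.

Lemma partmon_add_column z m lam : (size lam <= m)%N ->
  partmon z (add_column m lam) = (\prod_(1 <= k < m.+1) z k) * partmon z lam.
Proof.
move=> lm; rewrite (partmonE z lm) (@partmonE z _ m) ?size_mkseq //.
rewrite big_add1 big_mkord -big_split /=.
by apply: eq_bigr => k _; rewrite nth_mkseq // exprS.
Qed.

Lemma psum0 (z1 z2 : nat -> A) d :
  \sum_(lam \in parts 0 d) partmon z1 lam * partmon z2 lam = 1.
Proof.
rewrite (_ : parts 0 d = [set [::]]%classic); last first.
  apply/seteqP; split=> [lam [_]|lam ->] //=.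
  by rewrite leqn0 size_eq0 => /eqP.
by rewrite fsbig_set1 /partmon !big_ord0 mulr1.
Qed.

Lemma psumS (z1 z2 : nat -> A) n d : (n < d)%N ->
  \sum_(lam \in parts n.+1 d) partmon z1 lam * partmon z2 lam =
  \sum_(lam \in parts n d) partmon z1 lam * partmon z2 lam +
  (\prod_(1 <= k < n.+2) z1 k) * (\prod_(1 <= k < n.+2) z2 k) *
    \sum_(lam \in parts n.+1 (d - n.+1)) partmon z1 lam * partmon z2 lam.
Proof.
move=> nd; have fp := finite_parts n.+1 (d - n.+1).
rewrite (partsS nd) fsbigU0; last exact: parts_add_column_disjoint.
- congr (_ + _); rewrite fsbig_image; last first.
    move=> lam mu /set_mem[pl nl _] /set_mem[pm nm _].
    by apply: (@add_column_inj n.+1); exact: mem_set.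
  rewrite !fsbig_finite // mulr_sumr; apply: eq_big_seq => lam.
  rewrite in_fset_set // => /set_mem[_ nl _].
  by rewrite !partmon_add_column // mulrACA.
- exact: finite_parts.
exact: finite_image.
Qed.

End PartitionMonomials.
End Partitions.

(** * Truncated generating functions *)

Section Truncation.
Variable R : comNzRingType.
Local Notation pol := {malg R[{cmonom var}]}.
Implicit Types (f g : pol) (m : {cmonom var}) (w : nat -> nat).

Lemma mord_fsum d (I : choiceType) (D : set I) (F : I -> pol) :
  finite_set D -> (forall x, D x -> mord d (F x)) -> mord d (\sum_(x \in D) F x).
Proof.
move=> fD DF; rewrite fsbig_finite // big_seq; apply: mord_sum => x.
by rewrite in_fset_set // => /set_mem; exact: DF.
Qed.

Lemma mord_tpart lam : mord (sumn lam) (tpart R lam).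
Proof.
rewrite (sumn_nth (leqnn _)); apply: mord_prod => k.
by rewrite -[X in mord X]muln1; apply: mordX; exact: mordT1.
Qed.

Lemma mord_Tprod l : mord l (Tprod R l).
Proof.
rewrite -[X in mord X](_ : (\sum_(1 <= k < l.+1) 1 = l)%N).
  by apply: mord_prod => k; exact: mordT1.
by rewrite sum_nat_const_nat subn1 muln1.
Qed.

Lemma mord_prod1 d (I : Type) (r : seq I) (F : I -> pol) :
  (forall x, mord d (F x - 1)) -> mord d (\prod_(x <- r) F x - 1).
Proof.
move=> Fd; elim/big_rec: _ => [|x y _ yd]; first by rewrite subrr; exact: mord_zero.
have -> : F x * y - 1 = (F x - 1) * y + (y - 1).
  by rewrite (mulrBl y) mul1r addrA subrK.
by apply: mordD => //; apply: mordMl; exact: Fd.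
Qed.

(** Each factor is 1 modulo T_l, which has degree l; this makes the coefficients of the infinite
    product stabilize. *)
Lemma mord_A_factor l w :
  mord l (\big[*%R/1]_(alpha \in A_ l w) (1 - xmon R alpha * Tprod R l) - 1).
Proof.
rewrite fsbig_finite; last exact: finite_A_.
apply: mord_prod1 => alpha; rewrite addrAC subrr add0r.
by apply: mordN; apply: mordMr; exact: mord_Tprod.
Qed.

Lemma denomS n w : denom R n.+1 w =
  denom R n w * \big[*%R/1]_(alpha \in A_ n.+1 w) (1 - xmon R alpha * Tprod R n.+1).
Proof. by rewrite /denom big_nat_recr. Qed.

Lemma mord_denomS n w : mord n.+1 (denom R n.+1 w - denom R n w).
Proof.
rewrite denomS -[X in _ - X]mulr1 -(mulrBr (denom R n w)); apply: mordMr.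
exact: mord_A_factor.
Qed.

Lemma denom_stable m n w : (mdeg m <= n)%N ->
  (denom R n w)@_m = (denom R (mdeg m) w)@_m.
Proof.
move=> mn; rewrite -(subnKC mn); elim: (n - mdeg m)%N => [|k IH]; first by rewrite addn0.
rewrite addnS -[RHS]IH; apply/eqP; rewrite -subr_eq0 -mcoeffB; apply/eqP.
by apply: mord_denomS; rewrite ltnS leq_addr.
Qed.

Lemma denom_mone n w : (denom R n w)@_mone = 1.
Proof.
have : mord 1 (denom R n w - 1).
  rewrite /denom big_add1 /=; apply: mord_prod1 => l.
  exact: (mordW _ (@mord_A_factor l.+1 w)).
move/(_ mone); rewrite mdeg1 => /(_ isT)/eqP; rewrite mcoeffB subr_eq0 => /eqP ->.
by rewrite mcoeff1 eqxx.
Qed.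

Section Step.
Variables (n i : nat) (a : seq nat).
Hypotheses (ia : minimal_word (i :: a)) (nia : in_S n (word_perm (i :: a))).

Lemma denom_step :
  denom R n (word_perm (i :: a)) = denom R n (word_perm a) * Npol R (word_perm a) i.
Proof.
exact: (prod_denom_step (fun l alpha => 1 - xmon R alpha * Tprod R l) ia nia).
Qed.

Lemma swap_xmon alpha : swap i (xmon R alpha) = xmon R (s_seq i alpha).
Proof.
rewrite /xmon [LHS](rmorph_prod (swap i)) [RHS](perm_big (map (s_ i) alpha)) /=.
  by rewrite big_map; apply: eq_bigr => k _; exact: swapX.
by rewrite perm_sort.
Qed.

Lemma swap_Tprod l : swap i (Tprod R l) = Tprod R l.
Proof.
by rewrite /Tprod [LHS](rmorph_prod (swap i)); apply: eq_bigr => k _; exact: swapT.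
Qed.

Lemma swap_tpart lam : swap i (tpart R lam) = tpart R lam.
Proof.
rewrite /tpart [LHS](rmorph_prod (swap i)); apply: eq_bigr => k _ /=.
by rewrite [LHS](rmorphXn (swap i)) /= swapT.
Qed.

Lemma swap_denom :
  swap i (denom R n (word_perm (i :: a))) = denom R n (word_perm (i :: a)).
Proof.
apply: (@prod_denom_sym _ (fun l alpha => 1 - xmon R alpha * Tprod R l) n i a ia
  (swap i)) => l alpha.
exact: (rmorph_1subM (phi := swap i) (swap_xmon alpha) (swap_Tprod l)).
Qed.

End Step.

(** The series [Kn] cut at partitions of size d: a polynomial, so that [dpi] applies to it, and
    taken along a given word instead of the one chosen by [dpi_perm]. *)
Definition Ktrunc n d (a : seq nat) : pol :=
  \sum_(lam \in parts n d) dpi_word a (xpart R lam) * tpart R lam.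

Lemma dpi_Ktrunc n d i a : dpi i (Ktrunc n d a) = Ktrunc n d (i :: a).
Proof.
apply: (raddf_fsum (phi := dpi i) (finite_parts n d)) => lam.
by apply: dpiMr; exact: swap_tpart.
Qed.

Lemma denom_id n :
  denom R n id = \prod_(1 <= l < n.+1) (1 - xmon R (iota 1 l) * Tprod R l).
Proof. by apply: eq_bigr => l _; rewrite A_id fsbig_set1. Qed.

Lemma Ktrunc_nil n d :
  Ktrunc n d [::] = \sum_(lam \in parts n d) partmon (X R) lam * partmon (T R) lam.
Proof. by []. Qed.

Lemma mord_Ktrunc_nil n d d' : (d' <= d)%N ->
  mord d'.+1 (Ktrunc n d [::] - Ktrunc n d' [::]).
Proof.
move=> dd; rewrite /Ktrunc fsum_diff; last 2 first.
- exact: finite_parts.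
- by move=> lam [pl nl dl]; split=> //; exact: leq_trans dl dd.
apply: mord_fsum; first by apply: finite_setIl; exact: finite_parts.
move=> lam [[pl nl dl] h]; apply: mordMr; apply: (mordW _ (@mord_tpart lam)).
by rewrite ltnNge; apply/negP => h'; apply: h.
Qed.

(** Telescoping in n: up to order d+1, the factor 1 - y for l = n+1 reduces the sum over at most n+1
    parts to the sum over at most n parts. *)
Lemma mord_Ktrunc_id n d : mord d.+1 (Ktrunc n d [::] * denom R n id - 1).
Proof.
elim: n => [|n IH].
  have -> : denom R 0 id = 1 by rewrite denom_id big_nil.
  have -> : Ktrunc 0 d [::] = 1 by rewrite Ktrunc_nil psum0.
  by rewrite mulr1 subrr; exact: mord_zero.
pose y := xmon R (iota 1 n.+1) * Tprod R n.+1.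
have yE : y = (\prod_(1 <= k < n.+2) X R k) * (\prod_(1 <= k < n.+2) T R k).
  by rewrite /y /xmon -[iota 1 n.+1]/(index_iota 1 n.+2).
have ym : mord n.+1 y by apply: mordMr; exact: mord_Tprod.
have h : mord d.+1 (Ktrunc n.+1 d [::] * (1 - y) - Ktrunc n d [::]).
  have [nd|dn] := ltnP n d.
    have -> : Ktrunc n.+1 d [::] * (1 - y) - Ktrunc n d [::] =
        - (y * (Ktrunc n.+1 d [::] - Ktrunc n.+1 (d - n.+1) [::])).
      have := psumS (X R) (T R) nd; rewrite -yE -!Ktrunc_nil.
      move: (Ktrunc n.+1 d [::]) (Ktrunc n d [::]) (Ktrunc _ _ _) y {yE ym}.
      by move=> u v u' y ->; rewrite mulrBr mulr1 mulrDl mulrBr; ring.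
    (* The order is n+1 from [y] plus d-(n+1)+1 from the difference of truncations, which is d+1. *)
    apply: mordN; apply: (@mordW R (n.+1 + (d - n.+1).+1)%N); first lia.
    by apply: mordM => //; apply: mord_Ktrunc_nil; lia.
  (* For d <= n no partition of size at most d has n+1 parts, so only a multiple of [y] remains, of
     order n+1 > d. *)
  rewrite /Ktrunc parts_small // -/(Ktrunc n d [::]).
  rewrite (mulrBr (Ktrunc n d [::])) mulr1 addrAC subrr add0r; apply: mordN.
  by apply: mordMr; exact: (mordW _ ym).
rewrite denomS A_id fsbig_set1 -/y.
have -> : Ktrunc n.+1 d [::] * (denom R n id * (1 - y)) - 1 =
    (Ktrunc n.+1 d [::] * (1 - y) - Ktrunc n d [::]) * denom R n id +
    (Ktrunc n d [::] * denom R n id - 1).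
  move: (Ktrunc n.+1 d [::]) (Ktrunc n d [::]) (denom R n id) (1 - y) => u v D z.
  by rewrite mulrBl addrA subrK -mulrA (mulrC z).
exact: (mordD (mordMl (denom R n id) h) IH).
Qed.

(** The error for [i :: a] is pi_i applied to N_{w,i} times the error for [a], where w is the
    permutation of [a]; neither operation lowers the order, so one d serves the whole induction. *)
Lemma mord_Ktrunc n d a : minimal_word a -> in_S n (word_perm a) ->
  mord d.+1 (Ktrunc n d a * denom R n (word_perm a) - Ppol R a).
Proof.
elim: a => [|i a IH] ma na; first exact: mord_Ktrunc_id.
have [na' _] := minimal_word_in_S ma na.
have -> : Ktrunc n d (i :: a) * denom R n (word_perm (i :: a)) - Ppol R (i :: a) =
    dpi i ((Ktrunc n d a * denom R n (word_perm a) - Ppol R a) *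
           Npol R (word_perm a) i).
  rewrite -(dpi_Ktrunc n d i a).
  exact/esym/(raddf_step (phi := dpi i) _ (denom_step ma na)
    (dpiMr _ (swap_denom n ma))).
apply: mord_dpi; apply: mordMl; exact: IH (minimal_word_behead ma) na'.
Qed.

(** * Passage from truncations to power series *)

Lemma dpi_perm_word w a f : reduced_word w a -> dpi_perm w f = dpi_word a f.
Proof.
move=> wa; have [rb bw] := xgetPex [::] (ex_intro _ a wa).
have [ra aw] := wa.
apply: minimal_word_braid_eq; [exact: dpi_comm|exact: dpi_braid| | |].
- exact: reduced_minimal.
- exact: reduced_minimal.
by move=> k; rewrite bw aw.
Qed.

(** Since t^lam has degree |lam|, a partition larger than the degree of m contributes nothing at
    m. *)
Lemma Ksum_widen (L L' : set (seq nat)) w m : (L `<=` L')%classic ->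
    (forall lam, L' lam -> ~ L lam -> (mdeg m < sumn lam)%N) ->
  Ksum R L w m = Ksum R L' w m.
Proof.
move=> LL' h; apply: fsbig_widen => // lam [L'lam nLlam] /=.
by apply: (mordMr (Kpol R lam w) (@mord_tpart lam)); exact: h.
Qed.

Lemma Kn_Ktrunc n d w a m : reduced_word w a -> (mdeg m <= d)%N ->
  Kn R n w m = (Ktrunc n d a)@_m.
Proof.
move=> wa md; rewrite /Kn -(@Ksum_widen (parts n d)).
- apply/esym; apply: (raddf_fsum (phi := mcoeff m) (finite_parts n d)) => lam.
  by rewrite /Kpol (dpi_perm_word _ wa).
- by move=> lam [].
move=> lam [pl nl] npl; rewrite ltnNge; apply/negP => dl; apply: npl; split=> //.
exact: leq_trans dl md.
Qed.

Lemma Kall_Kn n w m : (mdeg m <= n)%N -> Kall R w m = Kn R n w m.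
Proof.
move=> mn; apply/esym/Ksum_widen => [lam []//|lam [sl pl] nlam].
rewrite ltnNge; apply/negP => h; apply: nlam; split=> //.
exact: leq_trans (size_le_sumn pl) (leq_trans h mn).
Qed.

Lemma Kn_denom n w a : in_S n w -> reduced_word w a ->
  Kn R n w * mseries_of (denom R n w) = mseries_of (Ppol R a).
Proof.
move=> wn wa; have [ra aw] := wa; have {aw}wE : word_perm a = w by apply/funext.
apply/funext => m; transitivity ((Ktrunc n (mdeg m) a * denom R n w)@_m).
  rewrite -mseries_mul_poly; apply: eq_mseries_mul => // e [e' ee'].
  by apply: (Kn_Ktrunc _ wa); rewrite -ee' mdegM leq_addr.
apply/eqP; rewrite -subr_eq0 -mcoeffB -wE; apply/eqP.
by apply: mord_Ktrunc => //; [exact: reduced_minimal|rewrite wE].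
Qed.

Lemma denom_inftyE n w m : (mdeg m <= n)%N -> denom_infty R w m = (denom R n w)@_m.
Proof.
move=> mn; rewrite /denom_infty /mseries_lim.
set P : set R := (X in xget _ X).
have PE : P (denom R (mdeg m) w)@_m.
  by exists (mdeg m) => L mL; exact: denom_stable.
(* The set is inhabited, so [xget] returns an eventual value; it is identified at an index beyond
   both [N] and [n]. *)
have [N h] := xgetI 0 PE.
by rewrite -(h (maxn N n) (leq_maxl _ _)) /mseries_of !denom_stable // (leq_trans mn) // leq_maxr.
Qed.

(** At a monomial m, [Kall] and the infinite product agree with their versions for N = max(n, deg
    m). As w lies in S_N and P_w does not involve n, the identity for S_N gives the coefficient. *)
Lemma Kall_denom n w a : in_S n w -> reduced_word w a ->
  Kall R w * denom_infty R w = mseries_of (Ppol R a).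
Proof.
move=> [wb w0 fixn] wa; apply/funext => m; pose N := maxn n (mdeg m).
have wN : in_S N w by split=> // k Nk; apply: fixn; exact: leq_ltn_trans (leq_maxl _ _) Nk.
rewrite -(Kn_denom wN wa); apply: eq_mseries_mul => e [e' ee'].
  by apply: Kall_Kn; rewrite /N -ee' mdegM; lia.
by apply: denom_inftyE; rewrite /N -ee' mdegM; lia.
Qed.

Lemma mseries_of_inj : injective (@mseries_of var R).
Proof. by move=> f g fg; apply/malgP => m; exact: (congr1 (fun h => h m) fg). Qed.

End Truncation.

Unset Implicit Arguments.

Theorem theorem3p9 (R : comNzRingType) (n : nat) (w : nat -> nat)
    (hn : (1 <= n)%N) (hw : in_S n w) :
  (forall a : seq nat, reduced_word w a ->
     Kn R n w = mseries_of (Ppol R a) / mseries_of (denom R n w) /\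
     Kall R w = mseries_of (Ppol R a) / denom_infty R w) /\
  (forall a b : seq nat, reduced_word w a -> reduced_word w b ->
     Ppol R a = Ppol R b).
Proof.
split=> [a wa|a b wa wb].
  split; first rewrite -(Kn_denom R hw wa) mulrK //.
    by apply: mseries_unit1; exact: denom_mone.
  rewrite -(Kall_denom R hw wa) mulrK //; apply: mseries_unit1.
  by rewrite (@denom_inftyE R 0) ?mdeg1 //; exact: denom_mone.
(* Both polynomials equal [Kn] times the denominator, and that product does not involve the word. *)
apply: mseries_of_inj.
exact: etrans (esym (Kn_denom R hw wa)) (Kn_denom R hw wb).
Qed.
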